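(* For any $\epsilon>0$, unless $P=NP$, there is no polynomial-time algorithm that approximates the optimal value of a bounded LPCC with binary data over $n$ variables within a factor of $n^{1-\epsilon}$ of its optimal value.
   Context: A linear program with linear complementarity constraints (LPCC), with data $c,d,b,q\in\mathbb{R}^n$ and $B,C,M,N\in\mathbb{R}^{n\times n}$, is the problem: maximize $c^\top x+d^\top y$ over $(x,y)$ subject to $Bx+Cy\geq b$, $Mx+Ny+q\geq 0$, $x\geq 0$, $x^\top(Mx+Ny+q)=0$. Binary data means all entries of the data are in $\{0,1\}$ up to sign (e.g. $M=A+I$ for a graph adjacency matrix $A$, $q=-\mathbf{e}$, $c=\mathbf{e}$); bounded means the optimal value is finite. Approximating within factor $n^{1-\epsilon}$ means outputting a value in $[n^{1-\epsilon}\cdot\mathrm{OPT}... ]$, i.e. a value between $\mathrm{OPT}/n^{1-\epsilon}$ and $\mathrm{OPT}$, where $\mathrm{OPT}$ is the optimal value. *)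

(* Defs.v *)
From HB Require Import structures.
From mathcomp Require Import all_boot all_order all_algebra.
From mathcomp Require Import boolp classical_sets reals exp.
Set Implicit Arguments.
Unset Strict Implicit.
Unset Printing Implicit Defensive.
Import Order.TTheory GRing.Theory Num.Theory.
Local Open Scope ring_scope.

Inductive sym := Blank | S0 | S1.
Inductive tmove := MoveL | MoveR | Stay.

(* states are 'I_(tm_Q.+1); the start state is ord0; [None] = halt *)
Record TM := {
  tm_Q : nat;
  tm_delta : 'I_tm_Q.+1 -> sym -> option ('I_tm_Q.+1 * sym * tmove) }.

(* configuration: state, left part of tape (reversed), head symbol, right part *)
Definition config (M : TM) : Type :=
  ('I_(tm_Q M).+1 * seq sym * sym * seq sym)%type.

Definition tm_step (M : TM) (c : config M) : option (config M) :=
  let: (q, l, h, r) := c in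
  match tm_delta q h with
  | None => None
  | Some (q', s, MoveL) =>
      Some (match l with [::] => (q', [::], Blank, s :: r)
                      | a :: l' => (q', l', a, s :: r) end)
  | Some (q', s, MoveR) =>
      Some (match r with [::] => (q', s :: l, Blank, [::])
                      | a :: r' => (q', s :: l, a, r') end)
  | Some (q', s, Stay) => Some (q', l, s, r)
  end.

Fixpoint tm_run (M : TM) (t : nat) (c : config M) : option (config M) :=
  match tm_step c with
  | None => Some c
  | Some c' => match t with 0 => None | t'.+1 => tm_run t' c' end
  end.

Definition sym_of_bool (b : bool) : sym := if b then S1 else S0.

Definition tm_init (M : TM) (x : seq bool) : config M :=
  match map sym_of_bool x with
  | [::] => (ord0, [::], Blank, [::])
  | a :: r => (ord0, [::], a, r)
  end.

Fixpoint read_bits (s : seq sym) : seq bool :=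
  match s with
  | S0 :: s' => false :: read_bits s'
  | S1 :: s' => true :: read_bits s'
  | _ => [::]
  end.

Definition tm_output_of (M : TM) (c : config M) : seq bool :=
  let: (_, _, h, r) := c in read_bits (h :: r).

Definition tm_outputs (M : TM) (x y : seq bool) : Prop :=
  exists t c, tm_run t (tm_init M x) = Some c /\ tm_output_of c = y.

Definition polytime (M : TM) : Prop :=
  exists k : nat, forall x : seq bool,
    exists c, tm_run ((size x).+2 ^ k) (tm_init M x) = Some c.

Definition pair_enc (x w : seq bool) : seq bool :=
  flatten [seq [:: b; b] | b <- x] ++ [:: false; true] ++ w.

Definition language := seq bool -> Prop.

Definition in_P (L : language) : Prop :=
  exists M : TM, polytime M /\ forall x, tm_outputs M x [:: true] <-> L x.

Definition in_NP (L : language) : Prop :=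
  exists (M : TM) (k : nat), polytime M /\
    forall x, L x <-> exists w : seq bool,
        (size w <= (size x).+2 ^ k)%N /\ tm_outputs M (pair_enc x w) [:: true].

Definition P_eq_NP : Prop := forall L : language, in_NP L -> in_P L.

Fixpoint bits_aux (f n : nat) : seq bool :=
  match f with
  | 0 => [::]
  | f'.+1 => if n == 0%N then [::] else odd n :: bits_aux f' n./2
  end.
Definition bits (n : nat) : seq bool := bits_aux n n.

Definition rat_enc (v : rat) : seq bool :=
  pair_enc ((numq v < 0) :: bits `|numq v|%N) (bits `|denq v|%N).

(*   maximize c^T x + d^T y  s.t.  Bx + Cy >= b, Mx + Ny + q >= 0,      *)
(*   x >= 0, x^T (Mx + Ny + q) = 0                                      *)
Record lpcc := {
  lp_dim : nat;
  lc : 'cV[int]_lp_dim; ld : 'cV[int]_lp_dim; lb : 'cV[int]_lp_dim; lq : 'cV[int]_lp_dim;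
  lB : 'M[int]_lp_dim; lC : 'M[int]_lp_dim; lM : 'M[int]_lp_dim; lN : 'M[int]_lp_dim }.

Definition binary_entry (z : int) : bool := z \in [:: -1; 0; 1].

Definition binary (I : lpcc) : Prop :=
  (forall i, [/\ binary_entry (lc I i ord0), binary_entry (ld I i ord0),
                 binary_entry (lb I i ord0) & binary_entry (lq I i ord0)]) /\
  (forall i j, [/\ binary_entry (lB I i j), binary_entry (lC I i j),
                   binary_entry (lM I i j) & binary_entry (lN I i j)]).

Section LPCCsem.
Variable R : realType.

Definition rmx (m n : nat) (A : 'M[int]_(m, n)) : 'M[R]_(m, n) := map_mx intr A.

Definition lpcc_feasible (I : lpcc) (x y : 'cV[R]_(lp_dim I)) : Prop :=
  let w := rmx (lM I) *m x + rmx (lN I) *m y + rmx (lq I) in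
  [/\ forall i, (rmx (lB I) *m x + rmx (lC I) *m y) i ord0 >= rmx (lb I) i ord0,
      forall i, w i ord0 >= 0,
      forall i, x i ord0 >= 0
    & \sum_i x i ord0 * w i ord0 = 0].

Definition lpcc_obj (I : lpcc) (x y : 'cV[R]_(lp_dim I)) : R :=
  \sum_i (rmx (lc I) i ord0 * x i ord0 + rmx (ld I) i ord0 * y i ord0).

Definition lpcc_values (I : lpcc) : set R :=
  [set v | exists x y, @lpcc_feasible I x y /\ v = @lpcc_obj I x y].

Definition lpcc_bounded (I : lpcc) : Prop := has_sup (lpcc_values I).

Definition lpcc_opt (I : lpcc) : R := sup (lpcc_values I).

Definition between (a b v : R) : Prop := Num.min a b <= v <= Num.max a b.
End LPCCsem.

Definition enc_entry (z : int) : seq bool :=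
  if z == 0 then [:: false; false]
  else if z == 1 then [:: false; true] else [:: true; true].

Definition enc_vec (n : nat) (v : 'cV[int]_n) : seq bool :=
  flatten [seq enc_entry (v i ord0) | i <- enum 'I_n].

Definition enc_mat (n : nat) (A : 'M[int]_n) : seq bool :=
  flatten [seq enc_entry (A i j) | i <- enum 'I_n, j <- enum 'I_n].

Definition enc_lpcc (I : lpcc) : seq bool :=
  nseq (lp_dim I) true ++ [:: false]
  ++ enc_vec (lc I) ++ enc_vec (ld I) ++ enc_vec (lb I) ++ enc_vec (lq I)
  ++ enc_mat (lB I) ++ enc_mat (lC I) ++ enc_mat (lM I) ++ enc_mat (lN I).

(* Main.v *)
(* The optimal value of an LPCC may be forced to be 0 or 1: a coordinate z >= 0 with slack 1 - z is
   complementary only for z in {0, 1}, and maximizing z subject to z <= sum of x over each group of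
   variables, with complementarity rows "x_i > 0 implies x_j = 0 for all j in conflict with i", asks
   whether every group contains a variable such that no two chosen ones conflict.  Any multiplicative
   approximation separates 0 from 1, so no gap amplification is needed.

   Such a choice problem expresses the tableau of a nondeterministic computation.  Groups are the cells
   (time, position) of the tableau, variables are windows of three adjacent contents, and conflicts are
   pairwise: horizontally adjacent windows must overlap, vertically adjacent ones must obey the local
   rule of the machine.  The exact bound (|x| + 2)^k on the witness is enforced by a marker that moves
   one position to the right in exactly (|x| + 2)^k rows and clears the witness bits it passes.

   Rows and columns of the instance are numbers in base l = 2|x| + 2, whose digits are positions in the
   word encoding x.  Every bit of the encoded instance is then determined by which digits of a counter
   N < l^K are zero, maximal, equal or consecutive, and by the letters they point at.  A machine that
   keeps the K digits as marks on the word, incrementing them like an odometer, therefore outputs the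
   instance in polynomial time.  It treats its tape as a queue (read and erase at the left end, append
   at the right end), so that three tape symbols suffice. *)
Require Import Defs.
From HB Require Import structures.
From mathcomp Require Import all_boot all_order all_fingroup all_algebra.
From mathcomp Require Import boolp classical_sets reals exp.
From mathcomp Require Import zify lra.
Set Implicit Arguments.
Unset Strict Implicit.
Unset Printing Implicit Defensive.
Import Order.TTheory GRing.Theory Num.Theory.
Local Open Scope ring_scope.

(** * Turing machines on a two-way infinite tape *)

Notation bitsym := sym_of_bool.

Section Tape.

Definition tape := int -> sym.
Definition icfg (Q : Type) := (Q * int * tape)%type.
Definition trans (Q : Type) := Q -> sym -> option (Q * sym * tmove).

Definition upd (T : tape) (p : int) (s : sym) : tape := fun z => if z == p then s else T z.
Definition mv (m : tmove) (p : int) : int :=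
  match m with MoveL => p - 1 | MoveR => p + 1 | Stay => p end.

Variables (Q : Type) (d : trans Q).

Definition istep (c : icfg Q) : option (icfg Q) :=
  let: (q, p, T) := c in
  if d q (T p) is Some (q', s, m) then Some (q', mv m p, upd T p s) else None.

Fixpoint irun (n : nat) (c c' : icfg Q) : Prop :=
  if n is n'.+1 then exists2 c1, istep c = Some c1 & irun n' c1 c' else c = c'.

Lemma irun_trans m n c1 c2 c3 : irun m c1 c2 -> irun n c2 c3 -> irun (m + n) c1 c3.
Proof.
elim: m c1 => [|m IH] c1 /=; first by move=> ->.
by case=> c h1 h2 h3; exists c => //; apply: IH.
Qed.

Lemma irun1 q p T q' s m : d q (T p) = Some (q', s, m) ->
  irun 1 (q, p, T) (q', mv m p, upd T p s).
Proof. by move=> h; exists (q', mv m p, upd T p s) => //=; rewrite h. Qed.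

Lemma upd_id T p : upd T p (T p) = T.
Proof. by apply: funext => z; rewrite /upd; case: eqP => [->|]. Qed.

Lemma irun_right q n p T :
  (forall b, d q (bitsym b) = Some (q, bitsym b, MoveR)) ->
  (forall i, (i < n)%N -> exists b, T (p + i%:Z) = bitsym b) ->
  irun n (q, p, T) (q, p + n%:Z, T).
Proof.
move=> hd; elim: n p => [|n IH] p hT /=; first by rewrite addr0.
have [b hb] := hT 0%N isT; rewrite addr0 in hb.
exists (q, p + 1, T); first by rewrite hb hd -hb upd_id.
rewrite (_ : p + n.+1%:Z = (p + 1) + n%:Z); last by lia.
apply: IH => i hi; have [b' hb'] := hT i.+1 hi; exists b'.
by rewrite -hb'; congr T; lia.
Qed.

Lemma irun_left q n p T :
  (forall b, d q (bitsym b) = Some (q, bitsym b, MoveL)) ->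
  (forall i, (i < n)%N -> exists b, T (p - i%:Z) = bitsym b) ->
  irun n (q, p, T) (q, p - n%:Z, T).
Proof.
move=> hd; elim: n p => [|n IH] p hT /=; first by rewrite subr0.
have [b hb] := hT 0%N isT; rewrite subr0 in hb.
exists (q, p - 1, T); first by rewrite hb hd -hb upd_id.
rewrite (_ : p - n.+1%:Z = (p - 1) - n%:Z); last by lia.
apply: IH => i hi; have [b' hb'] := hT i.+1 hi; exists b'.
by rewrite -hb'; congr T; lia.
Qed.

End Tape.

Definition word_at (a : int) (s : seq bool) : tape :=
  fun z => if (a <= z) && (z < a + (size s)%:Z) then bitsym (nth false s `|z - a|%N) else Blank.

(** The blank after [y] is what makes [read_bits] stop; the cells to the left of [p] and beyond that
    blank stay free. *)
Definition iout (p : int) (T : tape) (y : seq bool) : Prop :=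
  (forall i, (i < size y)%N -> T (p + i%:Z) = bitsym (nth false y i)) /\ T (p + (size y)%:Z) = Blank.

(** * Configurations made of two lists against configurations on the infinite tape *)

Section Rep.
Variable M : TM.
Local Notation d := (@tm_delta M).

(** Both lists are padded with [Blank], so configurations that differ only in trailing blanks
    represent the same tape. *)
Definition rep (c : config M) (ic : icfg 'I_(tm_Q M).+1) : Prop :=
  let: (q, l, h, r) := c in let: (q', p, T) := ic in
  [/\ q = q', T p = h, forall i : nat, T (p - i.+1%:Z) = nth Blank l i
    & forall i : nat, T (p + i.+1%:Z) = nth Blank r i].

Lemma rep_step c ic : rep c ic ->
  match tm_step c, istep d ic with
  | None, None => True | Some c', Some ic' => rep c' ic' | _, _ => False end.
Proof.
case: c => [[[q l] h] r]; case: ic => [[q' p] T] [<- hp hl hr] /=; rewrite hp.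
case: (tm_delta q h) => [[[q1 s] []]|] //=; rewrite /upd.
- case: l hl => [|a l] hl /=; split => //.
  + by rewrite ifF; [move: (hl 0%N) => /= <-; congr T; lia|lia].
  + by move=> i; rewrite ifF; [move: (hl i.+1) => /=; rewrite nth_nil => <-; congr T; lia|lia].
  + case=> [|i] /=; first by rewrite ifT //; lia.
    by rewrite ifF; [rewrite -hr; congr T; lia|lia].
  + by rewrite ifF; [move: (hl 0%N) => /= <-; congr T; lia|lia].
  + by move=> i; rewrite ifF; [move: (hl i.+1) => /= <-; congr T; lia|lia].
  + case=> [|i] /=; first by rewrite ifT //; lia.
    by rewrite ifF; [rewrite -hr; congr T; lia|lia].
- case: r hr => [|a r] hr /=; split => //.
  + by rewrite ifF; [move: (hr 0%N) => /= <-; congr T; lia|lia].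
  + case=> [|i] /=; first by rewrite ifT //; lia.
    by rewrite ifF; [rewrite -hl; congr T; lia|lia].
  + by move=> i; rewrite ifF; [move: (hr i.+1) => /=; rewrite nth_nil => <-; congr T; lia|lia].
  + by rewrite ifF; [move: (hr 0%N) => /= <-; congr T; lia|lia].
  + case=> [|i] /=; first by rewrite ifT //; lia.
    by rewrite ifF; [rewrite -hl; congr T; lia|lia].
  + by move=> i; rewrite ifF; [move: (hr i.+1) => /= <-; congr T; lia|lia].
- split => //; first by rewrite eqxx.
  + by move=> i; rewrite ifF ?hl //; lia.
  + by move=> i; rewrite ifF ?hr //; lia.
Qed.

Lemma rep_run t c ic : rep c ic ->
  forall c', tm_run t c = Some c' ->
  exists n ic', [/\ (n <= t)%N, irun d n ic ic', istep d ic' = None & rep c' ic'].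
Proof.
elim: t c ic => [|t IH] c ic hrep c' /=; have := rep_step hrep;
  case: (tm_step c) => [c1|]; case E: (istep d ic) => [ic1|] // h.
- by case=> <-; exists 0%N, ic.
- move=> hr; have [n [ic' [h1 h2 h3 h4]]] := IH _ _ h _ hr.
  by exists n.+1, ic'; split => //; exists ic1.
- by case=> <-; exists 0%N, ic.
Qed.

Lemma run_rep n c ic ic' : rep c ic -> irun d n ic ic' -> istep d ic' = None ->
  forall t, (n <= t)%N -> exists2 c', tm_run t c = Some c' & rep c' ic'.
Proof.
elim: n c ic => [|n IH] c ic hrep /=.
  move=> <- hN t _; have := rep_step hrep; rewrite hN.
  by case E: (tm_step c) => [c1|] // _; exists c => //; case: t => [|t] /=; rewrite E.
case=> ic1 h1 h2 hN [//|t] ht; have := rep_step hrep; rewrite h1.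
case E: (tm_step c) => [c1|] // hrep1.
have [c' e1 e2] := IH _ _ hrep1 h2 hN t ht.
by exists c' => //=; rewrite E.
Qed.

Lemma word_at_out a s z : ~~ ((a <= z) && (z < a + (size s)%:Z)) -> word_at a s z = Blank.
Proof. by rewrite /word_at => /negbTE ->. Qed.

Lemma word_at_in a s (i : nat) : (i < size s)%N -> word_at a s (a + i%:Z) = bitsym (nth false s i).
Proof.
move=> hi; rewrite /word_at ifT; last by lia.
by congr (bitsym (nth _ _ _)); lia.
Qed.

Lemma rep_init x a : rep (tm_init M x) (ord0, a, word_at a x).
Proof.
rewrite /tm_init /rep; case: x => [|b x].
  by split=> //= [|i|i]; rewrite ?nth_nil word_at_out //=; lia.
split=> //= [|i|i].
- by rewrite -[X in word_at _ _ X]addr0 (@word_at_in a (b :: x) 0).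
- by rewrite nth_nil word_at_out //; lia.
case: (ltnP i (size x)) => hi; first by rewrite word_at_in //= (nth_map false).
by rewrite nth_default ?size_map // word_at_out //=; lia.
Qed.

Lemma read_bitsP h r (T : tape) (p : int) y :
  T p = h -> (forall i : nat, T (p + i.+1%:Z) = nth Blank r i) ->
  read_bits (h :: r) = y <-> iout p T y.
Proof.
elim: y h r p => [|b y IH] h r p hp hr.
  rewrite /iout /= addr0 hp; split; first by case: h {hp}.
  by case=> _ ->.
have hr0 := hr 0%N.
have hrS i : T (p + 1 + i.+1%:Z) = nth Blank (behead r) i.
  by rewrite nth_behead -hr; congr T; lia.
have := IH (head Blank r) (behead r) (p + 1); rewrite -nth0 => /(_ hr0 hrS) {}IH.
have E1 : read_bits (h :: r) = b :: y <-> h = bitsym b /\ read_bits r = y.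
  by split; [case: h {hp} => //= -[<- <-] | case=> -> <-; case: b].
have E2 : iout p T (b :: y) <-> T p = bitsym b /\ iout (p + 1) T y.
  rewrite /iout /=; split.
    case=> h1 h2; split; first by have := h1 0%N isT; rewrite addr0.
    split; last by rewrite -h2; congr T; lia.
    by move=> i hi; rewrite -(h1 i.+1 hi); congr T; lia.
  case=> h1 [h2 h3]; split; last by rewrite -h3; congr T; lia.
  by case=> [|i] hi; [rewrite addr0 | rewrite /= -h2 //; congr T; lia].
(* An empty [r] has become a single blank, which also reads as the empty word. *)
rewrite E1 E2 hp -IH; suff -> : read_bits (nth Blank r 0 :: behead r) = read_bits r by [].
by case: (r).
Qed.

Lemma rep_output c ic y : rep c ic -> tm_output_of c = y <-> iout ic.1.2 ic.2 y.
Proof.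
case: c => [[[q l] h] r]; case: ic => [[q' p] T] [_ hp _ hr] /=.
exact: read_bitsP.
Qed.

Lemma tm_run_det t t' (c c1 c2 : config M) : tm_run t c = Some c1 -> tm_run t' c = Some c2 -> c1 = c2.
Proof.
elim: t t' c => [|t IH] [|t'] c /=; case E: (tm_step c) => [c'|] //; try by move=> [<-] [<-].
exact: IH.
Qed.

End Rep.

Arguments istep : simpl never.

(* The start state is renumbered to [ord0] by a transposition. *)
Lemma ord_enc (Q : finType) (q0 : Q) : exists n (f : Q -> 'I_n.+1) (g : 'I_n.+1 -> Q),
  [/\ cancel f g, cancel g f & f q0 = ord0].
Proof.
case E: #|Q| => [|n]; first by have := fintype0 q0 E.
pose e (q : Q) : 'I_n.+1 := cast_ord E (enum_rank q).
pose s := tperm (e q0) ord0.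
exists n, (fun q => s (e q)), (fun i => enum_val (cast_ord (esym E) (s i))); split.
- by move=> q; rewrite tpermK /e cast_ordK enum_rankK.
- by move=> i; rewrite /e enum_valK cast_ordKV tpermK.
- by rewrite tpermL.
Qed.

(** Machines can thus be designed over any finite type of states and on the infinite tape. A halting
    run survives extra fuel, so every [t] above the number of steps works. *)
Lemma realize (Q : finType) (q0 : Q) (d : trans Q) : exists M : TM,
  forall x n c', irun d n (q0, 0, word_at 0 x) c' -> istep d c' = None ->
  forall t, (n <= t)%N -> exists c : config M, tm_run t (tm_init M x) = Some c /\
    forall y, tm_output_of c = y <-> iout c'.1.2 c'.2 y.
Proof.
have [m [f [g [fK gK f0]]]] := ord_enc q0.
pose M := {| tm_Q := m; tm_delta := fun q s =>
   if d (g q) s is Some (q', s', mm) then Some (f q', s', mm) else None |}.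
exists M => x n c' hrun hhalt t ht.
pose F (c : icfg Q) : icfg 'I_m.+1 := (f c.1.1, c.1.2, c.2).
have stepF c : istep (@tm_delta M) (F c) = omap F (istep d c).
  case: c => [[q p] T]; rewrite /istep /= fK; by case: (d q (T p)) => [[[]]|].
have runF k c c1 : irun d k c c1 -> irun (@tm_delta M) k (F c) (F c1).
  elim: k c => [|k IH] c /=; first by move=> ->.
  by case=> c2 h1 h2; exists (F c2); [rewrite stepF h1 | exact: IH].
have r0 : rep (tm_init M x) (F (q0, 0, word_at 0 x)).
  by rewrite /F /= f0; apply: rep_init.
have [|c e1 e2] := run_rep r0 (runF _ _ _ hrun) _ ht; first by rewrite stepF hhalt.
by exists c; split=> // y; rewrite (rep_output _ e2).
Qed.

(** * Queue machines *)

Definition writes (T : tape) (p : int) (w : seq bool) : tape :=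
  fun z => if (p <= z) && (z < p + (size w)%:Z) then bitsym (nth false w `|z - p|%N) else T z.

Lemma writes_cons T p b w : writes T p (b :: w) = writes (upd T p (bitsym b)) (p + 1) w.
Proof.
apply: funext => z; rewrite /writes /upd /=.
case: (z =P p) => [->|hz].
  by rewrite ifT ?ifF; [rewrite subrr | lia | lia].
case: ifP => h1; case: ifP => h2; try lia; last by [].
by rewrite (_ : absz (z - p)%R = (absz (z - (p + 1))%R).+1) //; lia.
Qed.

Lemma writes_word_at a s w : writes (word_at a s) (a + (size s)%:Z) w = word_at a (s ++ w).
Proof.
apply: funext => z; rewrite /writes /word_at size_cat nth_cat.
case: ifP => h1.
  rewrite ifT; last by lia.
  by rewrite ifF; [congr (bitsym (nth _ _ _)); lia | lia].
case: ifP => h2; last by rewrite ifF //; lia.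
by rewrite !ifT //; lia.
Qed.

Lemma upd_pop a b s : upd (word_at a (b :: s)) a Blank = word_at (a + 1) s.
Proof.
apply: funext => z; rewrite /upd; case: (z =P a) => [->|hz].
  by rewrite word_at_out //; lia.
rewrite /word_at /=; case: ifP => h1; case: ifP => h2; try lia; last by [].
by rewrite (_ : absz (z - a)%R = (absz (z - (a + 1))%R).+1) //; lia.
Qed.

(** The word still to be written is kept in the state; [L] bounds what finitely many states can
    hold. *)
Lemma irun_write (Q : Type) (d : trans Q) (st : seq bool -> Q) L w p T :
  (forall b w s, (size w < L)%N -> d (st (b :: w)) s = Some (st w, bitsym b, MoveR)) ->
  (size w <= L)%N ->
  irun d (size w) (st w, p, T) (st [::], p + (size w)%:Z, writes T p w).
Proof.
move=> hd; elim: w p T => [|b w IH] p T /= hw.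
  rewrite addr0; congr (_, _, _); apply: funext => z; rewrite /writes ifF //=; lia.
exists (st w, p + 1, upd T p (bitsym b)); first by rewrite /istep hd.
by rewrite writes_cons (_ : p + (size w).+1%:Z = (p + 1) + (size w)%:Z); [apply: IH; apply: ltnW | lia].
Qed.

Lemma val_insub_bseq n (T : Type) (s : seq T) : (size s <= n)%N -> insub_bseq n s = s :> seq T.
Proof. by move=> h; rewrite /insub_bseq insubdK. Qed.

Section Sweep.
Variables (Sg Q : finType) (code : Sg -> seq bool) (dec : seq bool -> option Sg) (B : nat).
Hypothesis B_gt0 : (0 < B)%N.
Hypothesis size_code : forall c, size (code c) = B.
Hypothesis codeK : forall c, dec (code c) = Some c.
Variables (q0 : Q) (hlt : pred Q) (dl : Q -> Sg -> Q * seq bool).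
Variables (cw : bool -> seq bool) (fw : seq bool).

(** A state stores a partially read code word, [fw], the code of a raw letter, or the word appended
    by one transition; the sum is at least the length of each. *)
Definition wmax := (B + size fw + (size (cw true) + size (cw false)) +
  \max_(x : Q * Sg) size (dl x.1 x.2).2)%N.
Local Notation L := wmax.

Lemma size_dl q c : (size (dl q c).2 <= L)%N.
Proof. by apply: leq_trans (leq_addl _ _); rewrite (leq_bigmax (q, c)). Qed.

Definition gstate : finType := (('I_6 * L.-bseq bool) + (Q * 'I_4 * L.-bseq bool))%type.
Definition cst (i : 'I_6) (w : seq bool) : gstate := inl (i, insub_bseq L w).
Definition sst (i : 'I_4) q (w : seq bool) : gstate := inr (q, i, insub_bseq L w).
Local Notation "# i" := (@Ordinal 4 i isT) (at level 1, format "# i").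
Local Notation "## i" := (@Ordinal 6 i isT) (at level 1, format "## i").

(* The [inl] states move the raw input, letter by letter and coded by [cw], behind a blank separator:
   read and erase (0), cross the raw part (1), cross the codes (2), write (3), return (4, 5).  The [inr]
   states then simulate the queue machine: read a code word (0), go to the end (1), write (2), return (3). *)
Definition gen_delta : trans gstate := fun g s =>
  match g with
  | inl (i, w) =>
    match val i with
    | 0 => match s with
           | Blank => Some (sst #1 q0 fw, Blank, MoveR)
           | S0 => Some (cst ##1 (cw false), Blank, MoveR)
           | S1 => Some (cst ##1 (cw true), Blank, MoveR)
           end
    | 1 => if s is Blank then Some (cst ##2 w, s, MoveR) else Some (cst ##1 w, s, MoveR)
    | 2 => if s is Blank then Some (cst ##3 w, s, Stay) else Some (cst ##2 w, s, MoveR)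
    | 3 => if (w : seq bool) is b :: w' then Some (cst ##3 w', bitsym b, MoveR)
           else Some (cst ##4 [::], s, MoveL)
    | 4 => if s is Blank then Some (cst ##5 [::], s, MoveL) else Some (cst ##4 [::], s, MoveL)
    | _ => if s is Blank then Some (cst ##0 [::], s, MoveR) else Some (cst ##5 [::], s, MoveL)
    end
  | inr (q, i, w) =>
    match val i with
    | 0 => if hlt q then None else
           let rd b := let w' := rcons w b in
             if size w' == B then
               if dec w' is Some c then Some (sst #1 (dl q c).1 (dl q c).2, Blank, MoveR) else None
             else Some (sst #0 q w', Blank, MoveR) in
           match s with Blank => None | S0 => rd false | S1 => rd true end
    | 1 => if s is Blank then Some (sst #2 q w, s, Stay) else Some (sst #1 q w, s, MoveR)
    | 2 => if (w : seq bool) is b :: w' then Some (sst #2 q w', bitsym b, MoveR)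
           else Some (sst #3 q [::], s, MoveL)
    | _ => if s is Blank then Some (sst #0 q [::], s, MoveR) else Some (sst #3 q [::], s, MoveL)
    end
  end.
Local Notation run := (irun gen_delta).

Lemma run_push q (w : seq bool) a (u : seq bool) : (size w <= L)%N ->
  run (2 * (size u + size w) + 3)%N (sst #1 q w, a, word_at a u) (sst #0 q [::], a, word_at a (u ++ w)).
Proof.
move=> hw.
rewrite (_ : (_ + 3)%N = (size u + (1 + (size w + (1 + (size (u ++ w) + 1)))))%N); last first.
  by rewrite size_cat; lia.
apply: irun_trans.
  apply: (@irun_right _ _ _ (size u)); first by case; rewrite /= val_insub_bseq.
  by move=> i hi; rewrite word_at_in //; eexists.
apply: irun_trans.
  apply: irun1; rewrite word_at_out /=; last by lia.
  by rewrite val_insub_bseq.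
rewrite /= (_ : Blank = word_at a u (a + (size u)%:Z)); last by rewrite word_at_out //; lia.
rewrite upd_id; apply: irun_trans.
  apply: (@irun_write _ _ (sst #2 q) L) => // b w' s h.
  by rewrite /= val_insub_bseq //= /sst val_insub_bseq //; lia.
rewrite writes_word_at; apply: irun_trans.
  by apply: irun1; rewrite /= val_insub_bseq //.
rewrite /= upd_id; apply: irun_trans.
  apply: (@irun_left _ _ _ (size (u ++ w))); first by case.
  move=> i hi; exists (nth false (u ++ w) ((size (u ++ w)).-1 - i)).
  rewrite -(word_at_in a); last by lia.
  by congr word_at; move: hi; rewrite size_cat; lia.
have -> : a + (size u)%:Z + (size w)%:Z - 1 - (size (u ++ w))%:Z = a - 1 by rewrite size_cat; lia.
have hB : word_at a (u ++ w) (a - 1) = Blank by rewrite word_at_out //; lia.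
have := @irun1 _ gen_delta (sst #3 q [::]) (a - 1) (word_at a (u ++ w)) (sst #0 q [::]) Blank MoveR.
rewrite /= hB => /(_ erefl); rewrite /= -hB upd_id.
by rewrite (_ : a - 1 + 1 = a) //; lia.
Qed.

Lemma run_read q c u a : ~~ hlt q ->
  run B (sst #0 q [::], a, word_at a (code c ++ u))
        (sst #1 (dl q c).1 (dl q c).2, a + B%:Z, word_at (a + B%:Z) u).
Proof.
move=> hq; have hBL : (B <= L)%N by rewrite /wmax; lia.
(* Generalised to a code word of which [w1] has been read into the state and [w2] is still on the
   tape. *)
suff H k w2 w1 : code c = w1 ++ w2 -> size w2 = k.+1 -> forall a,
   run k.+1 (sst #0 q w1, a, word_at a (w2 ++ u))
     (sst #1 (dl q c).1 (dl q c).2, a + k.+1%:Z, word_at (a + k.+1%:Z) u).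
  have := H B.-1 (code c) [::] erefl; rewrite size_code prednK //; exact.
elim: k w2 w1 => [|k IH] [|b w2] w1 //= hc [hw] {}a.
- move/size0nil: hw => hw; subst w2.
  exists (sst #1 (dl q c).1 (dl q c).2, a + 1, word_at (a + 1) u) => //.
  rewrite /istep -[X in gen_delta _ (word_at _ _ X)]addr0 (@word_at_in a (b :: u) 0) //=.
  have hw1 : (size w1 < B)%N by rewrite -(size_code c) hc size_cat /=; lia.
  rewrite (negbTE hq) val_insub_bseq; last by lia.
  have hs : size (rcons w1 b) == B by rewrite -(size_code c) hc cats1.
  have hd : dec (rcons w1 b) = Some c by rewrite -cats1 -hc codeK.
  move: hs hd; case: b hc => hc hs hd; rewrite /= hs hd; by rewrite upd_pop.
have hw1 : size w1 + k.+2 = B :> nat by rewrite -(size_code c) hc size_cat /=; lia.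
exists (sst #0 q (rcons w1 b), a + 1, word_at (a + 1) (w2 ++ u)).
  rewrite /istep -[X in gen_delta _ (word_at _ _ X)]addr0 (@word_at_in a (b :: w2 ++ u) 0) //=.
  rewrite (negbTE hq) val_insub_bseq; last by lia.
  have hs b' : (size (rcons w1 b') == B) = false by rewrite size_rcons; lia.
  by case: b hc => hc; rewrite /= hs upd_pop.
rewrite (_ : a + k.+2%:Z = (a + 1) + k.+1%:Z); last by lia.
by apply: IH => //; rewrite cat_rcons.
Qed.

(** The queue machine proper: the place of the queue on the tape is forgotten. *)
Fixpoint smrun (n : nat) (q : Q) (u : seq bool) (q' : Q) (u' : seq bool) : Prop :=
  if n is n'.+1 then
    ~~ hlt q /\ exists c u1, u = code c ++ u1 /\ smrun n' (dl q c).1 (u1 ++ (dl q c).2) q' u'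
  else q = q' /\ u = u'.

Lemma smrun_trans m n q1 u1 q2 u2 q3 u3 :
  smrun m q1 u1 q2 u2 -> smrun n q2 u2 q3 u3 -> smrun (m + n) q1 u1 q3 u3.
Proof.
elim: m q1 u1 => [|m IH] q1 u1 /=; first by case=> -> ->.
by case=> h [c [u [-> h1]]] h2; split=> //; exists c, u; split=> //; apply: IH h1 h2.
Qed.

(** Pops erase on the left and pushes extend on the right, so the queue drifts to a new position
    [a']. During [n] steps its length is at most [size u + n * L], and one step costs a walk to the
    end and back. *)
Lemma smrun_sim n q u q' u' a : smrun n q u q' u' ->
  exists t a', (t <= n * (2 * (size u + n * L) + 2 * L + 3))%N /\
    run t (sst #0 q [::], a, word_at a u) (sst #0 q' [::], a', word_at a' u').
Proof.
elim: n q u a => [|n IH] q u a /=.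
  by case=> <- <-; exists 0%N, a; rewrite mul0n.
case=> hq [c [u1 [-> h]]].
have [t [a' [ht hr]]] := IH _ _ (a + B%:Z) h.
exists (B + (2 * (size u1 + size (dl q c).2) + 3) + t)%N, a'; split; last first.
  apply: irun_trans hr; apply: irun_trans; first exact: run_read.
  by apply: run_push; exact: size_dl.
have hL := size_dl q c; move: ht; rewrite !size_cat size_code => ht.
rewrite mulSn; apply: leq_add; first by lia.
apply: leq_trans ht _; rewrite leq_mul2l; apply/orP; right; lia.
Qed.

(** During the recoding, the unread input [r] ends just before the blank cell [e], and the codes [y]
    produced so far start right after it. *)
Definition tape2 a r e y : tape := fun z => if z <= e then word_at a r z else word_at (e + 1) y z.

Lemma tape2_pop a b r e y : a <= e ->
  upd (tape2 a (b :: r) e y) a Blank = tape2 (a + 1) r e y.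
Proof.
move=> ha; apply: funext => z; rewrite /tape2 -(upd_pop a b r) /upd; case: eqP => [->|//].
by rewrite ha.
Qed.

Lemma tape2_push a r e y w : writes (tape2 a r e y) (e + 1 + (size y)%:Z) w = tape2 a r e (y ++ w).
Proof.
apply: funext => z; rewrite /tape2 -writes_word_at /writes; case: ifP => // hz.
by rewrite ifF //; lia.
Qed.

Lemma tape2_nil a e : tape2 a [::] e = word_at (e + 1).
Proof.
apply: funext => y; apply: funext => z; rewrite /tape2; case: ifP => // hz.
by rewrite !word_at_out //=; lia.
Qed.

Lemma tape2_raw a r e y i : a + (size r)%:Z = e -> (i < size r)%N ->
  tape2 a r e y (a + i%:Z) = bitsym (nth false r i).
Proof. by move=> he hi; rewrite /tape2 ifT ?word_at_in //; lia. Qed.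

Lemma tape2_sep a r e y : a + (size r)%:Z = e -> tape2 a r e y e = Blank.
Proof. by move=> he; rewrite /tape2 lexx word_at_out //; lia. Qed.

Lemma tape2_code a r e y i : (i < size y)%N ->
  tape2 a r e y (e + 1 + i%:Z) = bitsym (nth false y i).
Proof. by move=> hi; rewrite /tape2 ifF ?word_at_in //; lia. Qed.

Lemma tape2_end a r e y : tape2 a r e y (e + 1 + (size y)%:Z) = Blank.
Proof. by rewrite /tape2 ifF ?word_at_out //; lia. Qed.

Lemma tape2_start a r e y : a + (size r)%:Z = e -> tape2 a r e y (a - 1) = Blank.
Proof. by move=> he; rewrite /tape2 ifT ?word_at_out //; lia. Qed.

Lemma run_code1 a b r e y : a + (size r)%:Z + 1 = e ->
  run (2 * (size r + size y + size (cw b)) + 6)%N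
    (cst ##0 [::], a, tape2 a (b :: r) e y) (cst ##0 [::], a + 1, tape2 (a + 1) r e (y ++ cw b)).
Proof.
move=> he; have he' : (a + 1) + (size r)%:Z = e by lia.
have hw : (size (cw b) <= L)%N by rewrite /wmax; case: b; lia.
set w := cw b in hw *.
(* The summands follow the states in order: erase, cross the raw part, the separator and the codes,
   write, then walk back over both parts. *)
rewrite (_ : (_ + 6)%N = (1 + (size r + (1 + (size y + (1 + (size w + (1 + (size (y ++ w) + (1 + (size r + 1))))))))))%N); last by rewrite size_cat; lia.
apply: irun_trans.
  apply: (@irun1 _ _ _ _ _ (cst ##1 w) Blank MoveR).
  rewrite -[X in tape2 _ _ _ _ X]addr0 tape2_raw //=; last by lia.
  by rewrite /w; case: (b).
rewrite /= tape2_pop; last by lia.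
apply: irun_trans.
  apply: (@irun_right _ _ _ (size r)); first by case; rewrite /= val_insub_bseq.
  by move=> i hi; rewrite tape2_raw //; eexists.
rewrite he'; apply: irun_trans.
  by apply: (@irun1 _ _ _ _ _ (cst ##2 w) Blank MoveR); rewrite tape2_sep //= val_insub_bseq.
rewrite /= -(tape2_sep y he') upd_id; apply: irun_trans.
  apply: (@irun_right _ _ _ (size y)); first by case; rewrite /= val_insub_bseq.
  by move=> i hi; rewrite tape2_code //; eexists.
apply: irun_trans.
  by apply: (@irun1 _ _ _ _ _ (cst ##3 w) Blank Stay); rewrite tape2_end //= val_insub_bseq.
rewrite /= -(tape2_end (a + 1) r e y) upd_id; apply: irun_trans.
  apply: (@irun_write _ _ (cst ##3) L) => // b' w' s h.
  by rewrite /= val_insub_bseq //= /cst val_insub_bseq //; lia.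
rewrite tape2_push; apply: irun_trans.
  by apply: irun1; rewrite /= val_insub_bseq.
rewrite /= upd_id; apply: irun_trans.
  apply: (@irun_left _ _ _ (size (y ++ w))); first by case.
  move=> i hi; exists (nth false (y ++ w) ((size (y ++ w)).-1 - i)).
  rewrite -(tape2_code (a + 1) r e); last by lia.
  by congr tape2; move: hi; rewrite size_cat; lia.
rewrite (_ : _ - _ = e); last by rewrite size_cat; lia.
apply: irun_trans.
  by apply: (@irun1 _ _ _ _ _ (cst ##5 [::]) Blank MoveL); rewrite tape2_sep.
rewrite /= -(tape2_sep (y ++ w) he') upd_id; apply: irun_trans.
  apply: (@irun_left _ _ _ (size r)); first by case.
  move=> i hi; exists (nth false r ((size r).-1 - i)).
  rewrite -(tape2_raw (y ++ w) he'); last by lia.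
  by congr tape2; lia.
rewrite (_ : e - 1 - (size r)%:Z = (a + 1) - 1); last by lia.
have := @irun1 _ gen_delta (cst ##5 [::]) (a + 1 - 1) (tape2 (a + 1) r e (y ++ w)) (cst ##0 [::]) Blank MoveR.
rewrite tape2_start // => /(_ erefl); rewrite -(tape2_start (y ++ w) he') upd_id.
by rewrite /= subrK.
Qed.

Lemma run_code a r e y : a + (size r)%:Z = e ->
  exists t, (t <= size r * (2 * (size r + size y + size r * L + L) + 6) + 1)%N /\
    run t (cst ##0 [::], a, tape2 a r e y) (sst #1 q0 fw, e + 1, word_at (e + 1) (y ++ flatten (map cw r))).
Proof.
elim: r a y => [|b r IH] a y he /=.
  exists 1%N; split=> //; rewrite cats0.
  have {he} -> : a = e by rewrite -he addr0.
  have := @irun1 _ gen_delta (cst ##0 [::]) e (tape2 e [::] e y) (sst #1 q0 fw) Blank MoveR.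
  have hs := @tape2_sep e [::] e y (addr0 _).
  by rewrite hs => /(_ erefl); rewrite -hs upd_id tape2_nil.
have he' : (a + 1) + (size r)%:Z = e by move: he => /=; lia.
have [t [ht hr]] := IH (a + 1) (y ++ cw b) he'.
exists ((2 * (size r + size y + size (cw b)) + 6) + t)%N; split.
  have hw : (size (cw b) <= L)%N by rewrite /wmax; case: (b); lia.
  move: ht; rewrite size_cat => ht.
  set X := (X in (_ <= _ * X + 1)%N).
  rewrite [(_ * X)%N]mulSn -[leqRHS]addnA; apply: leq_add; first by rewrite /X; lia.
  by apply: leq_trans ht _; rewrite leq_add2r leq_mul2l; apply/orP; right; rewrite /X; lia.
apply: irun_trans; first by apply: run_code1; lia.
by rewrite catA.
Qed.

Theorem gen_run x n q' y : smrun n q0 (flatten (map cw x) ++ fw) q' y -> hlt q' ->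
  exists t a, (t <= (size x + n + 1) * (4 * (size x + (size x + n + 1) * L) + 6 * L + 10) + 4)%N /\
  run t (cst ##0 [::], 0, word_at 0 x) (sst #0 q' [::], a, word_at a y) /\
  istep gen_delta (sst #0 q' [::], a, word_at a y) = None.
Proof.
move=> hr hq.
have [t1 [ht1 hr1]] := @run_code 0 x (size x)%:Z [::] (add0r _).
have [t2 [a [ht2 hr2]]] := smrun_sim ((size x)%:Z + 1) hr.
have hfw : (size fw <= L)%N by rewrite /wmax; lia.
have hcw : (size (flatten (map cw x)) <= size x * L)%N.
  elim: (x) => [//|b x' IH] /=; rewrite size_cat mulSn leq_add //.
  by rewrite /wmax; case: (b); lia.
exists (t1 + ((2 * (size (flatten (map cw x)) + size fw) + 3) + t2))%N, a; split.
  set W := (4 * (size x + (size x + n + 1) * L) + 6 * L + 10)%N.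
  have h1 : (t1 <= size x * W + 1)%N.
    apply: leq_trans ht1 _; rewrite leq_add2r leq_mul2l; apply/orP; right.
    by rewrite /W /= !mulnDl; lia.
  have h2 : (t2 <= n * W)%N.
    apply: leq_trans ht2 _; rewrite leq_mul2l; apply/orP; right.
    by rewrite /W size_cat !mulnDl; lia.
  have h3 : (2 * (size (flatten (map cw x)) + size fw) <= W)%N by rewrite /W !mulnDl; lia.
  by rewrite !mulnDl mul1n; lia.
split; last by rewrite /istep /= hq.
have e0 : tape2 0 x (size x)%:Z [::] = word_at 0 x.
  apply: funext => z; rewrite /tape2; case: ifP => // h.
  by rewrite !word_at_out //=; lia.
rewrite -e0; apply: irun_trans; first exact: hr1.
by apply: irun_trans hr2; rewrite cat0s; apply: run_push.
Qed.

End Sweep.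

(** * The odometer *)

Definition dg (l N a : nat) : nat := (N %/ l ^ a %% l)%N.

(** Adding one carries into position [a] exactly when all lower digits are maximal; the induction
    peels off the highest of these. *)
Lemma divn_succ l N a : (0 < l)%N ->
  (N.+1 %/ l ^ a = N %/ l ^ a + [forall b : 'I_a, dg l N b == l.-1])%N.
Proof.
move=> hl; elim: a => [|a IH].
  by rewrite !divn1 (_ : [forall _, _] = true) ?addn1 //; apply/forallP; case.
rewrite expnSr !divnMA IH.
have -> : [forall b : 'I_a.+1, dg l N b == l.-1] =
   [forall b : 'I_a, dg l N b == l.-1] && (dg l N a == l.-1).
  apply/forallP/andP => [h|[/forallP h1 h2] [b hb] /=].
    by split; [apply/forallP => b; exact: (h (widen_ord (leqnSn a) b)) | exact: (h ord_max)].
  have := hb; rewrite ltnS leq_eqVlt => /orP[/eqP -> //|hb'].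
  exact: (h1 (Ordinal hb')).
case: [forall b : 'I_a, _] => /=; last by rewrite !addn0.
rewrite addn1 divnS // addnC; congr (_ + nat_of_bool _)%N.
have := modnS (N %/ l ^ a) l; rewrite /dg; have := ltn_pmod (N %/ l ^ a) hl.
case: (boolP (l %| (N %/ l ^ a).+1)%N) => h1 h2 h3.
  apply/esym/eqP; move: h1; rewrite /dvdn -addn1 -modnDml => /eqP h4.
  case: (ltnP ((N %/ l ^ a) %% l + 1) l) => h5; first by move: h4; rewrite modn_small //; lia.
  by lia.
apply/esym/negbTE/eqP => h4; have := ltn_pmod (N %/ l ^ a).+1 hl; lia.
Qed.

Lemma dg_succ l N a : (0 < l)%N ->
  dg l N.+1 a = if [forall b : 'I_a, dg l N b == l.-1] then
                  (if dg l N a == l.-1 then 0%N else (dg l N a).+1) else dg l N a.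
Proof.
move=> hl; rewrite {1}/dg divn_succ //; case: ifP => _; last by rewrite addn0.
have h0 : (dg l N a < l)%N by rewrite ltn_pmod.
rewrite addn1 -addn1 -modnDml -/(dg l N a) addn1; case: eqP => h.
  by rewrite h prednK // modnn.
by rewrite modn_small //; lia.
Qed.

Lemma dg_last l N K : (0 < l)%N -> (N < l ^ K)%N ->
  [forall b : 'I_K, dg l N b == l.-1] = (N.+1 == l ^ K)%N.
Proof.
move=> hl hN; have := @divn_succ l N K hl; rewrite (divn_small hN) add0n => h.
apply/idP/eqP => [h1|h1].
  apply/eqP; rewrite eqn_leq hN /=; rewrite h1 in h.
  by rewrite leqNgt; apply/negP => h2; rewrite divn_small in h.
by move: h; rewrite h1 divnn expn_gt0 hl; case: [forall _, _].
Qed.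

Section Odometer.
Variables (P : finType) (p0 : P) (K : nat).
Notation marks := {ffun 'I_K -> bool}.
(** The marks on a letter tell which of the [K] digits currently point at its position. *)
Definition msym : finType := (P * marks)%type.
Notation V := msym.
Definition bset : finType := {ffun option V * V -> bool}.
Variable h : bset -> option V -> seq bool.

Definition qsym : finType := (V + option bool)%type.
Definition onehot (c : qsym) : seq bool := mkseq (fun i => i == enum_rank c) #|qsym|.
Definition onehot_dec (s : seq bool) : option qsym := [pick c | onehot c == s].

Lemma size_onehot c : size (onehot c) = #|qsym|.
Proof. by rewrite size_mkseq. Qed.

Lemma onehotK c : onehot_dec (onehot c) = Some c.
Proof.
rewrite /onehot_dec; case: pickP => [c' /eqP hc|/(_ c)]; last by rewrite eqxx.
congr Some; apply: enum_rank_inj; apply: val_inj => /=.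
have := congr1 (nth false ^~ (enum_rank c)) hc.
by rewrite /onehot !nth_mkseq // eqxx => /eqP.
Qed.

Lemma qsym_gt0 : (0 < #|qsym|)%N.
Proof. by apply/card_gt0P; exists (inr None). Qed.

Notation cV v := (inl v : qsym).
Notation cO b := (inr (Some b) : qsym).
Notation cEnd := (inr None : qsym).

Definition ostate : finType := ((bset * option V) + (marks * marks * option marks) + bool)%type.
Notation sE Z pv := (inl (inl (Z, pv)) : ostate).
Notation sU Sm L pm := (inl (inr (Sm, L, pm)) : ostate).
Notation sFin := (inr false : ostate).
Notation sHalt := (inr true : ostate).

Definition addb_set (Z : bset) (z : option V * V) : bset := [ffun y => Z y || (y == z)].
Definition bset0 : bset := [ffun _ => false].
Definition last_marks (pv : option V) : marks := if pv is Some v then v.2 else [ffun _ => false].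
(** [L] tells which digits are maximal; a digit moves when all lower ones are. *)
Definition carry (L : marks) : marks := [ffun a : 'I_K => [forall b : 'I_a, L (widen_ord (ltnW (ltn_ord a)) b)]].
(** A moving mark is taken over from the preceding letter, except that a mark at the last position
    wraps around to the letter without predecessor. *)
Definition upd_marks (Sm L : marks) (pm : option marks) (m : marks) : marks :=
  [ffun a => if Sm a then (if L a then pm == None else if pm is Some p then p a else false) else m a].
Definition codes (s : seq qsym) : seq bool := flatten (map onehot s).

(* The queue holds the marked word, the output so far and an end marker.  A pass in [inl (inl _)]
   collects the set of consecutive pairs of letters, which determines the next output [h]; a pass in
   [inl (inr _)] moves the marks in [Sm] one position to the right, cyclically, [L] being those at the
   last position; a pass in [inr false] leaves only the raw output. *)
Definition odl (q : ostate) (c : qsym) : ostate * seq bool :=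
  match q with
  | inl (inl (Z, pv)) =>
    match c with
    | inl v => (sE (addb_set Z (pv, v)) (Some v), onehot c)
    | inr (Some _) => (q, onehot c)
    | inr None => let L := last_marks pv in
       ((if [forall a, L a] then sFin else sU (carry L) L None),
        codes (map (fun b => cO b) (h Z pv)) ++ onehot cEnd)
    end
  | inl (inr (Sm, L, pm)) =>
    match c with
    | inl v => (sU Sm L (Some v.2), onehot (cV (v.1, upd_marks Sm L pm v.2)))
    | inr (Some _) => (q, onehot c)
    | inr None => (sE bset0 None, onehot cEnd)
    end
  | inr false =>
    match c with
    | inl v => (sFin, [::])
    | inr (Some b) => (sFin, [:: b])
    | inr None => (sHalt, [::])
    end
  | inr true => (sHalt, [::])
  end.

Definition ohlt : pred ostate := fun q => q == sHalt.
(** With every digit moving and declared maximal, the first pass puts all marks on the first letter: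
    the counter becomes 0 whatever marks the queue held. *)
Definition ostart : ostate := sU [ffun _ => true] [ffun _ => true] None.
Notation srun := (smrun onehot ohlt odl).

Fixpoint sweep q cs : ostate * seq bool :=
  if cs is c :: cs' then
    ((sweep (odl q c).1 cs').1, (odl q c).2 ++ (sweep (odl q c).1 cs').2) else (q, [::]).

Lemma sweep_cat q cs1 cs2 : sweep q (cs1 ++ cs2) =
  ((sweep (sweep q cs1).1 cs2).1, (sweep q cs1).2 ++ (sweep (sweep q cs1).1 cs2).2).
Proof.
elim: cs1 q => [|c cs IH] q /=; first by case: (sweep q cs2).
by rewrite IH /= catA.
Qed.

(** Only the end marker can lead to the halting state, so the machine runs through [cs] without
    stopping. *)
Lemma srun_sweep q cs u : ~~ ohlt q -> all (fun c => c != cEnd) cs ->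
  srun (size cs) q (codes cs ++ u) (sweep q cs).1 (u ++ (sweep q cs).2).
Proof.
elim: cs q u => [|c cs IH] q u hq /=; first by rewrite cats0.
case/andP=> hc hcs; split=> //.
exists c, (codes cs ++ u); split; first by rewrite catA.
rewrite -catA [u ++ (_ ++ _)]catA; apply: IH => //.
by case: q c hq hc => [[[Z pv]|[[Sm L] pm]]|[]] [v|[b|]].
Qed.

Lemma srun_pass q cs : ~~ ohlt q -> all (fun c => c != cEnd) cs ->
  srun (size cs).+1 q (codes (rcons cs cEnd))
   (sweep q (rcons cs cEnd)).1 (sweep q (rcons cs cEnd)).2.
Proof.
move=> hq hcs; rewrite -addn1; apply: smrun_trans.
  rewrite -cats1 /codes map_cat flatten_cat; exact: srun_sweep.
rewrite -cats1 sweep_cat /= !cats0; split.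
  elim: cs q hq hcs => [|c cs IH] q hq //= /andP[hc hcs].
  by apply: IH => //; case: q c hq hc => [[[Z pv]|[[Sm L] pm]]|[]] [v|[b|]].
by exists cEnd, (sweep q cs).2.
Qed.

Fixpoint bigrams (pv : option V) (s : seq V) : seq (option V * V) :=
  if s is v :: s' then (pv, v) :: bigrams (Some v) s' else [::].

Lemma sweepE Z pv s : sweep (sE Z pv) (map (fun v => cV v) s) =
  (sE [ffun z => Z z || (z \in bigrams pv s)] (if s is v :: s' then Some (last v s') else pv),
   codes (map (fun v => cV v) s)).
Proof.
elim: s Z pv => [|v s IH] Z pv /=.
  by congr (inl (inl (_, _)), _); apply/ffunP => z; rewrite ffunE in_nil orbF.
rewrite IH /=; congr (inl (inl (_, _)), _); last by case: s {IH}.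
by apply/ffunP => z; rewrite !ffunE in_cons orbA.
Qed.

Lemma sweepEO Z pv s : sweep (sE Z pv) (map (fun b => cO b) s) =
  (sE Z pv, codes (map (fun v => cO v) s)).
Proof. by elim: s => [|b s IH] //=; rewrite IH. Qed.

Lemma sweepUO Sm L pm s : sweep (sU Sm L pm) (map (fun b => cO b) s) =
  (sU Sm L pm, codes (map (fun v => cO v) s)).
Proof. by elim: s => [|b s IH] //=; rewrite IH. Qed.

Lemma sweepFV s : sweep sFin (map (fun v => cV v) s) = (sFin, [::]).
Proof. by elim: s => [|b s IH] //=; rewrite IH. Qed.

Lemma sweepFO s : sweep sFin (map (fun v => cO v) s) = (sFin, s).
Proof. by elim: s => [|b s IH] //=; rewrite IH. Qed.

Variable v : seq P.
Notation l := (size v).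
Hypothesis l_gt0 : (0 < l)%N.

Definition marked (m : nat -> marks) (j k : nat) : seq V := [seq (nth p0 v i, m i) | i <- iota j k].

(** The state remembers the old marks of the preceding letter, so a single pass from left to right
    can shift marks to the right. *)
Lemma sweepU Sm L (m : nat -> marks) j k :
  sweep (sU Sm L (if j is j'.+1 then Some (m j') else None)) (map (fun v => cV v) (marked m j k)) =
  (sU Sm L (if (j + k)%N is j'.+1 then Some (m j') else None),
   codes (map (fun v => cV v)
     (marked (fun i => upd_marks Sm L (if i is i'.+1 then Some (m i') else None) (m i)) j k))).
Proof.
elim: k j => [|k IH] j /=; first by rewrite addn0.
by rewrite (IH j.+1) /= addnS.
Qed.

Definition dmarks (N i : nat) : marks := [ffun a : 'I_K => dg l N a == i].
Definition round_out (N : nat) : seq bool :=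
  h [ffun z => z \in bigrams None (marked (dmarks N) 0 l)] (Some (nth p0 v l.-1, dmarks N l.-1)).
Definition outs (N : nat) : seq bool := flatten [seq round_out i | i <- iota 0 N].
Definition queue m N : seq bool :=
  codes (rcons (map (fun v => cV v) (marked m 0 l) ++ map (fun b => cO b) (outs N)) cEnd).

Lemma marked_nend m (s : seq bool) :
  all (fun c => c != cEnd) (map (fun v => cV v) (marked m 0 l) ++ map (fun b => cO b) s).
Proof. by rewrite all_cat !all_map; apply/andP; split; apply/allP. Qed.

Arguments smrun : simpl never.

Lemma srun_eq n q u q1 u1 q2 u2 :
  srun n q u q1 u1 -> q1 = q2 -> u1 = u2 -> srun n q u q2 u2.
Proof. by move=> h1 <- <-. Qed.

Lemma marked_rcons m : marked m 0 l = rcons (marked m 0 l.-1) (nth p0 v l.-1, m l.-1).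
Proof. by rewrite /marked -{1}(prednK l_gt0) -addn1 iotaD map_cat cats1. Qed.

Lemma codes_cat s1 s2 : codes (s1 ++ s2) = codes s1 ++ codes s2.
Proof. by rewrite /codes map_cat flatten_cat. Qed.

Lemma eval_pass N : (N < l ^ K)%N ->
  srun (l + size (outs N)).+1 (sE bset0 None) (queue (dmarks N) N)
   (if (N.+1 == l ^ K)%N then sFin else sU (carry (dmarks N l.-1)) (dmarks N l.-1) None)
   (queue (dmarks N) N.+1).
Proof.
move=> hN; have := @srun_pass (sE bset0 None) _ isT (marked_nend (dmarks N) (outs N)).
rewrite size_cat !size_map size_iota -/(queue _ _).
have E1 : (match marked (dmarks N) 0 l with [::] => None | v' :: s' => Some (last v' s') end) =
          Some (nth p0 v l.-1, dmarks N l.-1).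
  by rewrite marked_rcons; case: (marked _ 0 l.-1) => //= y s; rewrite last_rcons.
have E2 : [forall a, dmarks N l.-1 a] = (N.+1 == l ^ K)%N.
  by rewrite -dg_last //; apply: eq_forallb => a; rewrite ffunE.
rewrite -cats1 !sweep_cat sweepE E1 /= sweepEO /= E2 cats0 => H.
apply: srun_eq H _ _ => //.
rewrite /queue -cats1 !codes_cat -!catA; congr (_ ++ _).
rewrite /outs -addn1 iotaD map_cat flatten_cat map_cat codes_cat /= add0n -!catA; congr (_ ++ _).
rewrite cats0 [codes [:: _]]/codes /= cats0; congr (codes (map _ _) ++ _).
by congr h; apply/ffunP => z; rewrite !ffunE.
Qed.

Lemma update_pass Sm L N m m' : (forall i, (i < l)%N ->
   upd_marks Sm L (if i is i'.+1 then Some (m i') else None) (m i) = m' i) ->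
  srun (l + size (outs N)).+1 (sU Sm L None) (queue m N) (sE bset0 None) (queue m' N).
Proof.
move=> hm; have := @srun_pass (sU Sm L None) _ isT (marked_nend m (outs N)).
rewrite size_cat !size_map size_iota -/(queue _ _).
rewrite -cats1 !sweep_cat (sweepU Sm L m 0 l) sweepUO /= cats0.
move=> H; apply: srun_eq H _ _ => //.
rewrite [X in codes (map _ X)](_ : _ = marked m' 0 l); last first.
  by apply/eq_in_map => i; rewrite mem_iota => /andP[_ hi]; rewrite hm.
by rewrite /queue -cats1 !codes_cat /codes /= cats0 -!catA.
Qed.

(** By [dg_succ], moving the marks under the carry rule is addition of one. *)
Lemma upd_dmarks N i : (i < l)%N ->
  upd_marks (carry (dmarks N l.-1)) (dmarks N l.-1)
    (if i is i'.+1 then Some (dmarks N i') else None) (dmarks N i) = dmarks N.+1 i.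
Proof.
move=> hi; apply/ffunP => a; rewrite !ffunE dg_succ //.
have -> : [forall b : 'I_a, dmarks N l.-1 (widen_ord (ltnW (ltn_ord a)) b)] =
   [forall b : 'I_a, dg l N b == l.-1] by apply: eq_forallb => b; rewrite ffunE.
case: ifP => // _; case: ifP => // _; first by case: i hi.
by case: i hi => [|i] hi //; rewrite ffunE.
Qed.

(** The raw bits appended in this pass are never read back: the end marker is popped before them and
    halts the machine. *)
Lemma fin_pass m N : srun (l + size (outs N)).+1 sFin (queue m N) sHalt (outs N).
Proof.
have := @srun_pass sFin _ isT (marked_nend m (outs N)).
by rewrite size_cat !size_map size_iota -/(queue _ _) -cats1 !sweep_cat sweepFV sweepFO /= cats0.
Qed.

Definition hmax := (\max_(x : bset * option V) size (h x.1 x.2))%N.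

Lemma size_outs N : (size (outs N) <= N * hmax)%N.
Proof.
rewrite /outs -{2}(size_iota 0 N); elim: (iota 0 N) => [|i s IH] //=.
rewrite size_cat mulSn leq_add // /round_out.
exact: (leq_bigmax (_, _)).
Qed.

(** One pass sets the counter to 0, each of its [l ^ K] values takes an evaluation, all but the last
    an update, and one pass strips the codes: [2 * l ^ K + 1] passes, each over the word, at most
    [l ^ K * hmax] output bits and the end marker. *)
Theorem odometer_run (m : nat -> marks) : exists n,
  (n <= (2 * l ^ K + 1) * (l + l ^ K * hmax + 1))%N /\
  srun n ostart (queue m 0) sHalt (outs (l ^ K)).
Proof.
set X := (l + l ^ K * hmax + 1)%N.
have lK : (0 < l ^ K)%N by rewrite expn_gt0 l_gt0.
have hX N : (N <= l ^ K)%N -> ((l + size (outs N)).+1 <= X)%N.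
  move=> hN; rewrite /X addn1 ltnS leq_add2l; apply: leq_trans (size_outs _) _.
  by rewrite leq_mul2r hN orbT.
have H : forall k, (k < l ^ K)%N -> exists n, (n <= (2 * k + 1) * X)%N /\
    srun n ostart (queue m 0) (sE bset0 None) (queue (dmarks k) k).
  elim=> [|k IH] hk.
    exists (l + size (outs 0)).+1; rewrite mul1n hX //; split=> //.
    apply: update_pass => i hi; apply/ffunP => a; rewrite !ffunE /dg div0n mod0n.
    by case: i hi.
  have [n [hn hr]] := IH (ltnW hk).
  exists (n + ((l + size (outs k)).+1 + (l + size (outs k.+1)).+1))%N; split.
    have h1 := hX k (ltnW (ltnW hk)); have h2 := hX k.+1 (ltnW hk).
    have -> : ((2 * k.+1 + 1) * X = (2 * k + 1) * X + (X + X))%N by lia.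
    by rewrite leq_add // leq_add.
  apply: smrun_trans hr _; apply: smrun_trans (eval_pass (ltnW hk)) _.
  rewrite ifF; last by lia.
  by apply: update_pass => i hi; exact: upd_dmarks.
have hp : ((l ^ K).-1 < l ^ K)%N by rewrite prednK.
have [n [hn hr]] := H _ hp.
exists (n + ((l + size (outs (l ^ K).-1)).+1 + (l + size (outs (l ^ K))).+1))%N; split.
  have h1 := hX _ (ltnW hp); have h2 := hX _ (leqnn (l ^ K)%N).
  have -> : ((2 * l ^ K + 1) * X = (2 * (l ^ K).-1 + 1) * X + (X + X))%N.
    by rewrite -{1}(prednK lK); lia.
  by rewrite leq_add // leq_add.
apply: smrun_trans hr _; apply: smrun_trans (eval_pass hp) _.
by rewrite prednK // eqxx; apply: fin_pass.
Qed.

End Odometer.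

(** * Polynomial bounds and composition of machines *)

(** The base [n.+2] is at least 2, so exponents can always be enlarged and constants are absorbed;
    it is also the base used in [polytime]. *)
Definition polyb (f : nat -> nat) : Prop := exists k, forall n, (f n <= n.+2 ^ k)%N.

Lemma polyb_leq f g : (forall n, (f n <= g n)%N) -> polyb g -> polyb f.
Proof. by move=> h [k hk]; exists k => n; apply: leq_trans (h n) (hk n). Qed.

Lemma polyb_const c : polyb (fun=> c).
Proof.
exists c => n; apply: leq_trans (ltnW (ltn_expl c (isT : (1 < 2)%N))) _.
by case: c => // c; rewrite leq_exp2r.
Qed.

Lemma leq_exp_base n k k' : (k <= k')%N -> (n.+2 ^ k <= n.+2 ^ k')%N.
Proof. by move=> h; rewrite leq_exp2l. Qed.

Lemma polyb_id : polyb (fun n => n).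
Proof. by exists 1%N => n; rewrite expn1; lia. Qed.

Lemma polyb_add f g : polyb f -> polyb g -> polyb (fun n => f n + g n)%N.
Proof.
move=> [a ha] [b hb]; exists (a + b).+1 => n.
have h1 : (n.+2 ^ a <= n.+2 ^ (a + b))%N by apply: leq_exp_base; lia.
have h2 : (n.+2 ^ b <= n.+2 ^ (a + b))%N by apply: leq_exp_base; lia.
rewrite expnS; have := ha n; have := hb n; nia.
Qed.

Lemma polyb_mul f g : polyb f -> polyb g -> polyb (fun n => f n * g n)%N.
Proof. by move=> [a ha] [b hb]; exists (a + b)%N => n; rewrite expnD leq_mul. Qed.

Lemma polyb_exp f k : polyb f -> polyb (fun n => f n ^ k)%N.
Proof.
move=> [a ha]; exists (a * k)%N => n; rewrite expnM.
by case: k => // k; rewrite leq_exp2r.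
Qed.

(** * Sequential composition of machines *)

Section Seq.
Variables (Q1 Q2 : Type) (d1 : trans Q1) (d2 : trans Q2) (q2 : Q2).

(** Halting of the first machine turns into one stationary step, after which the second starts where
    the head of the first stopped. *)
Definition seqd : trans (Q1 + Q2) := fun q s =>
  match q with
  | inl q => if d1 q s is Some (q', s', m) then Some (inl q', s', m) else Some (inr q2, s, Stay)
  | inr q => if d2 q s is Some (q', s', m) then Some (inr q', s', m) else None
  end.

Lemma seq_run n m q p T q' p' T' q'' p'' T'' :
  irun d1 n (q, p, T) (q', p', T') -> istep d1 (q', p', T') = None ->
  irun d2 m (q2, p', T') (q'', p'', T'') ->
  irun seqd (n + (1 + m)) (inl q, p, T) (inr q'', p'', T'').
Proof.
move=> h1 hN h2; apply: (@irun_trans _ _ _ _ _ (inl q', p', T')).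
  elim: n q p T h1 => [|n IH] q p T /=; first by case=> -> -> ->.
  case=> [[[q1 p1] T1]] e h; exists (inl q1, p1, T1); last exact: IH.
  by move: e; rewrite /istep /=; case: (d1 q (T p)) => [[[a b] c]|] // [<- <- <-].
apply: (@irun_trans _ _ _ _ _ (inr q2, p', T')).
  exists (inr q2, p', T') => //; move: hN; rewrite /istep /=.
  by case: (d1 q' (T' p')) => [[[]]|] // _; rewrite /= upd_id.
elim: m q2 p' T' h2 {h1 hN} => [|m IH] q1 p1 T1 /=; first by case=> -> -> ->.
case=> [[[q3 p3] T3]] e h; exists (inr q3, p3, T3); last exact: IH.
by move: e; rewrite /istep /=; case: (d2 q1 (T1 p1)) => [[[a b] c]|] // [<- <- <-].
Qed.

Lemma seq_halt q p T : istep d2 (q, p, T) = None -> istep seqd (inr q, p, T) = None.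
Proof. by rewrite /istep /=; case: (d2 q (T p)) => [[[]]|]. Qed.

End Seq.

(** * The machine that writes the instance *)

Section Generator.
Variables (K : nat) (h : bset (bool * bool)%type K -> option (msym (bool * bool)%type K) -> seq bool).

(* The second component flags exactly [size x + 2] positions. *)
Definition base_word (x : seq bool) : seq (bool * bool) :=
  flatten [seq [:: (b, true); (b, false)] | b <- x] ++ [:: (false, true); (true, true)].
Definition generated (x : seq bool) : seq bool :=
  outs (false, false) h (base_word x) (size (base_word x) ^ K).

Lemma size_base_word x : size (base_word x) = ((size x).*2.+2)%N.
Proof.
rewrite size_cat addn2; congr _.+2.
by elim: x => //= b x IH; rewrite IH.
Qed.

Let P : finType := (bool * bool)%type.
Let cV (b c : bool) : seq bool := onehot (inl ((b, c), [ffun=> false]) : qsym P K).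

(** The final tape holds nothing but the generated word, with the head on its first cell, so another
    machine can start on it directly. *)
Lemma generator : exists (Q : finType) (q0 : Q) (d : trans Q) (f : nat -> nat), polyb f /\
  forall x, (size (generated x) <= f (size x))%N /\ exists t q a, [/\ (t <= f (size x))%N,
    irun d t (q0, 0, word_at 0 x) (q, a, word_at a (generated x)) &
    istep d (q, a, word_at a (generated x)) = None].
Proof.
pose cw b := cV b true ++ cV b false.
pose fw := cV false true ++ cV true true ++ onehot (inr None : qsym P K).
pose Lw := wmax #|qsym P K| (odl h) cw fw.
(* The recoded input is a legitimate initial queue: each letter of [x] becomes two unmarked letters,
   and [fw] supplies the last two letters and the end marker. *)
have hq x : queue (false, false) h (base_word x) (fun=> [ffun=> false]) 0 = flatten (map cw x) ++ fw.
  rewrite /queue /outs /= cats0 -cats1 /codes map_cat flatten_cat /=.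
  have -> : marked (false, false) (base_word x) (fun=> [ffun=> false]) 0 (size (base_word x)) =
            [seq (c, [ffun=> false]) | c <- base_word x] :> seq (msym P K).
    rewrite /marked -{3}[base_word x](mkseq_nth (false, false)) /mkseq -map_comp.
    by [].
  rewrite /base_word !map_cat flatten_cat /= cats0 -!catA; congr (_ ++ _); last by rewrite cats0.
  by elim: (x) => [|b y IH] /=; rewrite ?IH /cw -?catA.
(* The bound of [odometer_run] for a word of length [n.*2.+2]. *)
pose X n := ((2 * n.*2.+2 ^ K + 1) * (n.*2.+2 + n.*2.+2 ^ K * hmax h + 1))%N.
pose G := gstate #|qsym P K| (odl h) cw fw.
pose g0 : G := cst #|qsym P K| (odl h) cw fw (@Ordinal 6 0 isT) [::].
pose dG : trans G := @gen_delta _ _ (@onehot_dec P K) #|qsym P K| (ostart P K) (@ohlt P K) (odl h) cw fw.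
pose f n := ((n + X n + 1) * (4 * (n + (n + X n + 1) * Lw) + 6 * Lw + 10) + 4)%N.
exists G, g0, dG, f; split.
  have hl : polyb (fun n => n.*2.+2).
    apply: (@polyb_leq _ (fun n => n + n + 2)%N); first by move=> n; lia.
    by do !apply: polyb_add; try exact: polyb_id; exact: polyb_const.
  have hX : polyb X.
    apply: polyb_mul; repeat (apply: polyb_add || apply: polyb_mul || apply: polyb_exp); by [|exact: polyb_const].
  by repeat (apply: polyb_add || apply: polyb_mul || apply: polyb_exp); rewrite //; try exact: polyb_const; exact: polyb_id.
move=> x; split.
  apply: leq_trans (size_outs _ _ _ _) _; rewrite size_base_word.
  apply: (@leq_trans (X (size x))).
    by rewrite /X; set Y := (_ ^ K * hmax h)%N; rewrite mulnDl; lia.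
  apply: leq_trans (leq_addr _ _); apply: leq_trans (leq_pmulr _ _); first by lia.
  by rewrite addn_gt0 orbT.
have hl : (0 < size (base_word x))%N by rewrite size_base_word.
have [n [hn hr]] := odometer_run (false, false) h hl (fun=> [ffun=> false]).
rewrite hq in hr.
have [t [a [ht [hr1 hr2]]]] := gen_run (qsym_gt0 P K) (@size_onehot P K) (@onehotK P K) hr isT.
exists t, (sst #|qsym P K| (odl h) cw fw (@Ordinal 4 0 isT) (inr true) [::]), a; split => //.
apply: leq_trans ht _; rewrite size_base_word -/(X (size x)) in hn.
rewrite leq_add2r; apply: leq_mul; first by lia.
rewrite !leq_add2r leq_mul2l leq_add2l leq_mul2r; apply/orP; right; apply/orP; right; lia.
Qed.

End Generator.

(** Compares the third and fourth letters of the word under the head: states 3 and 4 remember the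
    third. If they agree, a 1 followed by a blank is left as output, otherwise a blank. *)
Definition check_delta : trans 'I_7 := fun q s =>
  let st i : 'I_7 := inord i in
  match val q with
  | 0 => Some (st 1, s, MoveR)
  | 1 => Some (st 2, s, MoveR)
  | 2 => Some (st (if s is S0 then 3 else 4), s, MoveR)
  | 3 => if s is S0 then Some (st 5, S1, MoveR) else Some (st 6, Blank, Stay)
  | 4 => if s is S1 then Some (st 5, S1, MoveR) else Some (st 6, Blank, Stay)
  | 5 => Some (st 6, Blank, MoveL)
  | _ => None
  end.

Lemma check_run p T y : iout p T y -> (4 <= size y)%N ->
  exists n q p' T', [/\ (n <= 5)%N, irun check_delta n (inord 0, p, T) (q, p', T'),
    istep check_delta (q, p', T') = None &
    iout p' T' [:: true] <-> nth false y 2 = nth false y 3].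
Proof.
move=> [hy _] hs.
have h2 : T (p + 1 + 1) = bitsym (nth false y 2) by rewrite -hy; [congr T; lia | lia].
have h3 : T (p + 1 + 1 + 1) = bitsym (nth false y 3) by rewrite -hy; [congr T; lia | lia].
have r1 : irun check_delta 3 (inord 0, p, T) (inord (if nth false y 2 then 4 else 3), p + 1 + 1 + 1, T).
  exists (inord 1, p + 1, T); first by rewrite /istep /check_delta /= inordK //= upd_id.
  exists (inord 2, p + 1 + 1, T); first by rewrite /istep /check_delta /= inordK //= upd_id.
  exists (inord (if nth false y 2 then 4 else 3), p + 1 + 1 + 1, T) => //.
  by rewrite /istep /check_delta /= inordK //= upd_id h2; case: (nth false y 2).
case: (eqVneq (nth false y 2) (nth false y 3)) => [e|ne].
- exists 5%N, (inord 6), (p + 1 + 1 + 1 + 1 - 1), (upd (upd T (p + 1 + 1 + 1) S1) (p + 1 + 1 + 1 + 1) Blank).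
  split => //.
  + apply: (irun_trans r1); exists (inord 5, p + 1 + 1 + 1 + 1, upd T (p + 1 + 1 + 1) S1).
      by rewrite /istep /check_delta /= h3 -e; case: (nth false y 2); rewrite inordK.
    by exists (inord 6, p + 1 + 1 + 1 + 1 - 1, upd (upd T (p + 1 + 1 + 1) S1) (p + 1 + 1 + 1 + 1) Blank); rewrite // /istep /check_delta /= inordK.
  + by rewrite /istep /check_delta /= inordK.
  + split=> // _; split=> [[|i] //= _|/=]; rewrite /upd.
      by rewrite ifF ?ifT //; lia.
    by rewrite ifT //; lia.
- exists 4%N, (inord 6), (p + 1 + 1 + 1), (upd T (p + 1 + 1 + 1) Blank); split => //.
  + apply: (irun_trans r1); exists (inord 6, p + 1 + 1 + 1, upd T (p + 1 + 1 + 1) Blank) => //.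
    by move: ne; rewrite /istep /check_delta /= h3; case: (nth false y 2); case: (nth false y 3) => //; rewrite inordK.
  + by rewrite /istep /check_delta /= inordK.
  + split=> [[/(_ 0%N isT)]|/eqP]; last by rewrite (negbTE ne).
    by rewrite addr0 /upd eqxx.
Qed.

(** The decider runs the generator, then [M], then the comparison. As [h] does not depend on [x],
    this is a single machine. *)
Theorem reduction_in_P (K : nat) (h : bset (bool * bool)%type K -> option (msym (bool * bool)%type K) -> seq bool)
  (M : TM) (L : language) : polytime M ->
  (forall x, exists y, [/\ tm_outputs M (generated h x) y, (4 <= size y)%N &
      L x <-> nth false y 2 = nth false y 3]) -> in_P L.
Proof.
move=> [kM hM] hL; have [Q [q0 [d [f [[kf hf] hgen]]]]] := generator h.
have [N hN] := realize (inl (inl q0)) (seqd (seqd d (@tm_delta M) ord0) check_delta (inord 0)).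
pose F n := (f n + (1 + (n.+2 + f n + 1).+2 ^ kM) + (1 + 5))%N.
have hdec x : exists n c', [/\ (n <= F (size x))%N,
    irun (seqd (seqd d (@tm_delta M) ord0) check_delta (inord 0)) n (inl (inl q0), 0, word_at 0 x) c',
    istep (seqd (seqd d (@tm_delta M) ord0) check_delta (inord 0)) c' = None &
    iout c'.1.2 c'.2 [:: true] <-> L x].
  have [hs [t [q [a [ht hr hh]]]]] := hgen x.
  have [y [[t' [c [hc hy]]] hsy hLy]] := hL x.
  (* [hM] provides a halting run within the polynomial bound, and determinism identifies it with the
     run that outputs [y]. *)
  have [c1 hc1] := hM (generated h x).
  have ? := tm_run_det hc1 hc; subst c1.
  have [n [[[q1 p1] T1] [hn hr1 hh1 hrep]]] := rep_run (rep_init M _ a) hc1.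
  have hout : iout p1 T1 y by apply/(rep_output y hrep).
  have [m [q2 [p2 [T2 [hm hr2 hh2 hres]]]]] := check_run hout hsy.
  exists ((t + (1 + n)) + (1 + m))%N, (inr q2, p2, T2); split.
  - rewrite /F; apply: leq_add; last by rewrite leq_add2l.
    apply: leq_add => //; rewrite leq_add2l.
    apply: leq_trans hn _; case: (kM) => // k; rewrite leq_exp2r //; lia.
  - apply: seq_run hr2; first exact: seq_run hr hh hr1.
    exact: seq_halt.
  - exact: seq_halt.
  - by rewrite hLy.
exists N; split.
  have [k hk] : polyb F.
    have pf : polyb f by exists kf.
    apply: polyb_add; last exact: polyb_const.
    apply: polyb_add => //; apply: polyb_add; first exact: polyb_const.
    apply: polyb_exp; apply: (@polyb_leq _ (fun n => n + f n + 5)%N); first by move=> n; lia.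
    apply: polyb_add; last exact: polyb_const.
    by apply: polyb_add => //; exact: polyb_id.
  exists k => x; have [n [c' [hn hr hh _]]] := hdec x.
  by have [|c [hc _]] := hN x n c' hr hh (((size x).+2 ^ k)%N); [apply: leq_trans hn _ | exists c].
move=> x; have [n [c' [_ hr hh hiff]]] := hdec x.
have [c [hc hout]] := hN x n c' hr hh n (leqnn n).
rewrite -hiff -hout; split=> [[t [c1 [hc1 <-]]]|ho]; last by exists n, c.
by rewrite (tm_run_det hc hc1).
Qed.

(** * Computation tableaux as tilings *)

Definition sym_code (s : sym) : option bool :=
  match s with Blank => None | S0 => Some false | S1 => Some true end.
Definition code_sym (b : option bool) : sym := if b is Some b then bitsym b else Blank.
Lemma sym_codeK : cancel sym_code code_sym. Proof. by case. Qed.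
HB.instance Definition _ := Finite.copy sym (can_type sym_codeK).

Definition is_bit (s : sym) : bool := sym_code s.

Section Automaton.
Variable V : TM.
Local Notation d := (@tm_delta V).
Local Notation St := 'I_(tm_Q V).+1.

(* Head state, symbol, marker, and whether a witness bit still has to be passed by the marker. *)
Definition cell : finType := (option St * sym * bool * bool)%type.
Definition chead (c : cell) : option St := c.1.1.1.
Definition csym (c : cell) : sym := c.1.1.2.
Definition cmark (c : cell) : bool := c.1.2.
Definition cpend (c : cell) : bool := c.2.

Definition going_right (c : cell) : option St :=
  if chead c is Some q then if d q (csym c) is Some (q', _, MoveR) then Some q' else None else None.
Definition going_left (c : cell) : option St :=
  if chead c is Some q then if d q (csym c) is Some (q', _, MoveL) then Some q' else None else None.

(** A halted head stays put, so the final configuration persists to the last row. On a tick the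
    marker moves one cell to the right and clears the pending flag of the cell it enters. *)
Definition ca_rule (tick : bool) (x y z : cell) : cell :=
  let hs := if chead y is Some q then
      match d q (csym y) with
      | None => (Some q, csym y) | Some (q', s, Stay) => (Some q', s) | Some (_, s, _) => (None, s)
      end
    else (if going_right x is Some q then Some q else going_left z, csym y) in
  (hs, if tick then cmark x else cmark y, cpend y && ~~ (tick && cmark x)).

Definition nstep (c : icfg St) : icfg St := odflt c (istep d c).

Lemma iter_nstep n c c' : irun d n c c' -> istep d c' = None ->
  forall k, (n <= k)%N -> iter k nstep c = c'.
Proof.
move=> h1 h2 k /subnK <-; rewrite iterD.
have -> : iter n nstep c = c'.
  elim: n c h1 => [//|n IH] c /= [c1 e h]; rewrite -iterS iterSr.
  by rewrite {2}/nstep e /=; apply: IH.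
by elim: (k - n)%N => //= m ->; rewrite /nstep h2.
Qed.

Definition marked_cell (c : icfg St) (s : int) (m u : bool) : cell :=
  ((if s == c.1.2 then Some c.1.1 else None), c.2 s, m, u).

(** A head affects only its own cell and the neighbour it moves to; hence the cases head at [s], at
    [s - 1], at [s + 1], and elsewhere. *)
Lemma ca_rule_head c s tick m1 u1 m2 u2 m3 u3 :
  (ca_rule tick (marked_cell c (s - 1) m1 u1) (marked_cell c s m2 u2) (marked_cell c (s + 1) m3 u3)).1.1 =
  ((if s == (nstep c).1.2 then Some (nstep c).1.1 else None), (nstep c).2 s).
Proof.
case: c => [[q p] T]; rewrite /ca_rule /marked_cell /going_right /going_left /chead /csym /cmark /cpend /=.
rewrite /nstep /istep.
case: (s =P p) => [->|hs].
  case: (d q (T p)) => [[[q' s'] []]|] /=; rewrite /upd ?eqxx //.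
  - by rewrite ifF //; lia.
  - by rewrite ifF //; lia.
case: (s - 1 =P p) => h1.
  have -> : (s + 1 == p) = false by lia.
  rewrite h1; case: (d q (T p)) => [[[q' s'] []]|] /=; rewrite /upd.
  - by rewrite !ifF //; lia.
  - by rewrite ifT ?ifF //; lia.
  - by rewrite !ifF //; lia.
  - by rewrite ifF //; lia.
case: (s + 1 =P p) => h2.
  rewrite h2; case: (d q (T p)) => [[[q' s'] []]|] /=; rewrite /upd.
  - by rewrite ifT ?ifF //; lia.
  - by rewrite !ifF //; lia.
  - by rewrite !ifF //; lia.
  - by rewrite ifF //; lia.
case: (d q (T p)) => [[[q' s'] []]|] /=; rewrite /upd; by rewrite !ifF //; lia.
Qed.

Variables (x : seq bool) (s0 W Tn : nat) (tick : nat -> bool).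
Local Notation base := (pair_enc x [::]).
Local Notation l := (size base).
Definition ticks t : nat := (\sum_(0 <= i < t) tick i)%N.

Definition tile : finType := (cell * cell * cell)%type.
Definition tl_left (a : tile) : cell := a.1.1.
Definition tl_mid (a : tile) : cell := a.1.2.
Definition tl_right (a : tile) : cell := a.2.

(** Beyond the fixed part the symbol is free: this is where the witness is guessed, and each of its
    bits is pending. The marker starts on the last fixed cell. *)
Definition init_ok (s : nat) (y : cell) : bool :=
  if (s < s0)%N then y == (None, Blank, false, false)
  else if (s < s0 + l)%N then
    y == ((if s == s0 then Some ord0 else None), bitsym (nth false base (s - s0)), s == (s0 + l).-1, false)
  else [&& chead y == None, ~~ cmark y & cpend y == is_bit (csym y)].
(** The absence of pending bits bounds the length of the witness; a halted head on [S1] followed by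
    a non-bit means the output [[:: true]]. *)
Definition final_ok (a : tile) : bool :=
  ~~ cpend (tl_mid a) && (if chead (tl_mid a) is Some q then
      [&& ~~ isSome (d q (csym (tl_mid a))), csym (tl_mid a) == S1 & ~~ is_bit (csym (tl_right a))] else true).
Definition self_ok (t s : nat) (a : tile) : bool :=
  [&& (s == 0%N) ==> (chead (tl_left a) == None) && ~~ cmark (tl_left a),
      (s == W.-1) ==> (chead (tl_right a) == None),
      (t == 0%N) ==> init_ok s (tl_mid a) & (t == Tn.-1) ==> final_ok a].
(** The last condition propagates blanks to the right on row 0, so that the guessed witness is one
    contiguous block. *)
Definition hor_ok (t s : nat) (a b : tile) : bool :=
  [&& tl_mid a == tl_left b, tl_right a == tl_mid b &
      (t == 0%N) && (s0 + l <= s)%N && (csym (tl_mid a) == Blank) ==> (csym (tl_mid b) == Blank)].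
Definition ver_ok (t : nat) (a b : tile) : bool :=
  tl_mid b == ca_rule (tick t) (tl_left a) (tl_mid a) (tl_right a).

Definition tiling (A : nat -> nat -> tile) : Prop :=
  [/\ forall t s, (t < Tn)%N -> (s < W)%N -> self_ok t s (A t s),
      forall t s, (t < Tn)%N -> (s.+1 < W)%N -> hor_ok t s (A t s) (A t s.+1)
    & forall t s, (t.+1 < Tn)%N -> (s < W)%N -> ver_ok t (A t s) (A t.+1 s)].

(** The two size conditions keep the head and the marker away from the edges during all [Tn]
    rows. *)
Hypotheses (Tn_gt0 : (0 < Tn)%N) (Tn_s0 : (Tn <= s0)%N) (W_big : (s0 + Tn + l + ticks Tn.-1 < W)%N).
Hypothesis time_ok : forall w, (size w <= ticks Tn.-1)%N ->
  exists c, tm_run Tn.-1 (tm_init V (pair_enc x w)) = Some c.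

Lemma pair_enc_cat w : pair_enc x w = base ++ w.
Proof. by rewrite /pair_enc cats0 -catA. Qed.

Lemma l_ge2 : (2 <= l)%N.
Proof. by rewrite /pair_enc !size_cat /=; lia. Qed.

Section Rows.
Variable w : seq bool.
Local Notation inp := (pair_enc x w).
Definition ic0 : icfg St := (ord0, s0%:Z, word_at s0%:Z inp).
Definition ic t : icfg St := iter t nstep ic0.
Definition mpos t : int := ((s0 + l).-1 + ticks t)%N%:Z.
Definition row (t : nat) (s : int) : cell :=
  marked_cell (ic t) s (s == mpos t)
    ((((s0 + l)%N%:Z <= s) && (s < (s0 + size inp)%N%:Z)) && ~~ (s <= mpos t)).

Lemma ticksS t : ticks t.+1 = (ticks t + tick t)%N.
Proof. by rewrite /ticks big_nat_recr. Qed.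

Lemma row_step t s : row t.+1 s = ca_rule (tick t) (row t (s - 1)) (row t s) (row t (s + 1)).
Proof.
have h := @ca_rule_head (ic t) s (tick t).
rewrite [LHS]surjective_pairing [RHS]surjective_pairing; congr (_, _); last first.
  rewrite /row /ca_rule /marked_cell /cpend /cmark /= /mpos ticksS.
  by case: (tick t) => /=; lia.
rewrite [LHS]surjective_pairing [RHS]surjective_pairing; congr (_, _); last first.
  rewrite /row /ca_rule /marked_cell /cpend /cmark /= /mpos ticksS.
  by case: (tick t) => /=; lia.
by rewrite /row h.
Qed.

Lemma ic_pos t : (s0%:Z - t%:Z <= (ic t).1.2) && ((ic t).1.2 <= s0%:Z + t%:Z).
Proof.
elim: t => [|t IH]; first by rewrite /ic /=; lia.
rewrite /ic iterS -/(ic t); move: IH; case: (ic t) => [[q p] T].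
rewrite /nstep /istep; case: (d q (T p)) => [[[q' s'] []]|] /=; lia.
Qed.

Lemma row_sym_end s : (s0 + size inp <= s)%N -> csym (row 0 s%:Z) = Blank.
Proof. by move=> h; rewrite /row /marked_cell /csym /= word_at_out //; lia. Qed.

Lemma row_sym_in s : (s0 <= s)%N -> (s < s0 + size inp)%N ->
  csym (row 0 s%:Z) = bitsym (nth false inp (s - s0)).
Proof.
move=> h1 h2; rewrite /row /marked_cell /csym /=.
by rewrite (_ : s%:Z = s0%:Z + (s - s0)%N%:Z) ?word_at_in //; lia.
Qed.

(** By [time_ok] the machine has halted by the last row, so acceptance can be read off two cells
    there. *)
Lemma accept_row : (size w <= ticks Tn.-1)%N ->
  tm_outputs V inp [:: true] <->
  let c := ic Tn.-1 in istep d c = None /\ c.2 c.1.2 = S1 /\ ~~ is_bit (c.2 (c.1.2 + 1)).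
Proof.
move=> hw; have [c hc] := time_ok hw.
have [n [ic' [hn hr hh hrep]]] := rep_run (rep_init V inp s0%:Z) hc.
have -> : ic Tn.-1 = ic' by apply: iter_nstep hn.
rewrite /=; have hout := rep_output [:: true] hrep.
split.
  case=> t [c1 [hc1 ho]]; rewrite (tm_run_det hc1 hc) in ho.
  have [h0 h1] := (iffLR hout) ho; split=> //; split.
    by rewrite -(addr0 ic'.1.2) (h0 0%N).
  by rewrite h1.
case=> _ [h0 h1]; exists Tn.-1, c; split=> //; apply/hout; split=> [[|i] // _|/=].
  by rewrite addr0 h0.
by case: (ic'.2 _) h1.
Qed.

End Rows.

Lemma row_init w s : init_ok s (row w 0 s%:Z).
Proof.
have hl := l_ge2; have hsz : size (pair_enc x w) = (l + size w)%N by rewrite pair_enc_cat size_cat.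
rewrite /init_ok; case: ifP => h1.
  rewrite /row /marked_cell /= ifF; last by lia.
  rewrite word_at_out; last by rewrite hsz; lia.
  by rewrite /mpos /ticks big_nil; apply/eqP; congr (_, _, _, _); lia.
case: ifP => h2.
  have hsym := @row_sym_in w s; move: hsym; rewrite hsz => /(_ ltac:(lia) ltac:(lia)).
  rewrite pair_enc_cat nth_cat ifT; last by lia.
  rewrite /row /marked_cell /csym /= => ->; rewrite /mpos /ticks big_nil addn0.
  by apply/eqP; congr (_, _, _, _); lia.
rewrite /row /marked_cell /chead /cmark /cpend /csym /=.
rewrite ifF /=; last by lia.
rewrite /mpos /ticks big_nil addn0; apply/andP; split; first by lia.
case: (ltnP s (s0 + l + size w)) => h3.
  have := @row_sym_in w s; rewrite hsz => /(_ ltac:(lia) ltac:(lia)).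
  rewrite /row /marked_cell /csym /= => ->.
  have -> : is_bit (bitsym (nth false (pair_enc x w) (s - s0))) by case: (nth _ _ _).
  by apply/eqP; lia.
have := @row_sym_end w s; rewrite hsz => /(_ ltac:(lia)).
by rewrite /row /marked_cell /csym /= => ->; apply/eqP; rewrite /is_bit /=; lia.
Qed.

Lemma init_ok_inj s c c' : init_ok s c -> init_ok s c' ->
  ((s0 + l <= s)%N -> csym c = csym c') -> c = c'.
Proof.
rewrite /init_ok; case: ifP => _; first by move=> /eqP -> /eqP ->.
case: ifP => h; first by move=> /eqP -> /eqP ->.
case: c => [[[h1 s1] m1] u1]; case: c' => [[[h2 s2] m2] u2].
rewrite /chead /cmark /cpend /csym /= => /and3P[/eqP -> /negbTE -> /eqP ->] /and3P[/eqP -> /negbTE -> /eqP ->].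
by move=> /(_ ltac:(lia)) ->.
Qed.

Lemma tiling_complete w : (size w <= ticks Tn.-1)%N -> tm_outputs V (pair_enc x w) [:: true] ->
  tiling (fun t s => (row w t (s%:Z - 1), row w t s%:Z, row w t (s%:Z + 1))).
Proof.
move=> hw hacc; have hl := l_ge2.
have hsz : size (pair_enc x w) = (l + size w)%N by rewrite pair_enc_cat size_cat.
split.
- move=> t s ht hs; rewrite /self_ok /tl_left /tl_mid /tl_right /=.
  have hp := ic_pos w t.
  apply/and4P; split; apply/implyP => /eqP e.
  + rewrite /row /marked_cell /chead /cmark /= e.
    rewrite ifF /=; last by lia.
    by rewrite /mpos; lia.
  + by rewrite /row /marked_cell /chead /= ifF //; lia.
  + by rewrite e; apply: row_init.
  + rewrite e /final_ok /tl_mid /tl_right /=; apply/andP; split.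
      (* On the last row the marker has moved [ticks Tn.-1] cells past the fixed part, hence past
         the whole witness. *)
      rewrite /row /marked_cell /cpend /= /mpos hsz; lia.
    have [h1 [h2 h3]] := (iffLR (accept_row hw)) hacc.
    rewrite /row /marked_cell /chead /csym /=.
    case: (s%:Z =P (ic w Tn.-1).1.2) => // e2.
    rewrite e2 h2 h3 eqxx andbT /= andbT.
    move: h1 h2; case: (ic w Tn.-1) => [[q p] T]; rewrite /istep /= => h1 h2; rewrite -{1}h2.
    by case: (d q (T p)) h1 => [[[]]|].
- move=> t s ht hs; rewrite /hor_ok /tl_left /tl_mid /tl_right /=.
  have e1 : (s.+1)%:Z - 1 = s%:Z by lia.
  have e2 : s%:Z + 1 = (s.+1)%:Z by lia.
  rewrite e1 e2 !eqxx /=; apply/implyP => /andP[/andP[/eqP -> h1] /eqP h2].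
  case: (leqP (s0 + size (pair_enc x w)) s) => h3.
    by rewrite row_sym_end //; lia.
  by have := @row_sym_in w s; rewrite h2 => /(_ ltac:(lia) h3); case: (nth _ _ _).
- move=> t s ht hs; rewrite /ver_ok /tl_mid /tl_left /tl_right /=.
  by rewrite row_step.
Qed.

Lemma ca_rule_left tick' a b y z : going_right a = going_right b -> cmark a = cmark b ->
  ca_rule tick' a y z = ca_rule tick' b y z.
Proof. by rewrite /ca_rule => -> ->. Qed.

Lemma ca_rule_right tick' a y z z' : going_left z = going_left z' ->
  ca_rule tick' a y z = ca_rule tick' a y z'.
Proof. by rewrite /ca_rule => ->. Qed.

(** Row 0 of the tiling determines a witness [w]; by induction on [t], the middle cells of row [t]
    are then those of the computation on [w], since [ver_ok] leaves no choice. *)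
Lemma tiling_sound A : tiling A ->
  exists w, (size w <= ticks Tn.-1)%N /\ tm_outputs V (pair_enc x w) [:: true].
Proof.
move=> [hself hhor hver]; have hl := l_ge2.
pose y t s := tl_mid (A t s).
pose bits_of k := csym (y 0%N (s0 + l + k)%N).
(* the witness is the maximal block of bits following the encoding of x on row 0 *)
pose R := (W - (s0 + l))%N.
pose k0 := find (fun k => ~~ is_bit (bits_of k)) (iota 0 R).
pose w := [seq sym_code (bits_of k) == Some true | k <- iota 0 k0].
have hk0 : (k0 <= R)%N by rewrite /k0 -[X in (_ <= X)%N](size_iota 0 R) find_size.
have hin k : (k < k0)%N -> is_bit (bits_of k).
  move=> h; have := @before_find _ 0%N _ _ _ h; rewrite nth_iota ?add0n; last by lia.
  by move/negbFE.
have hbl k : (k0 <= k)%N -> (k < R)%N -> bits_of k = Blank.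
  move=> h1 h2; have h3 : ~~ is_bit (bits_of k0).
    have hh : has (fun k => ~~ is_bit (bits_of k)) (iota 0 R) by rewrite has_find size_iota; rewrite -/k0; lia.
    by have := nth_find 0%N hh; rewrite -/k0 nth_iota ?add0n //; lia.
  have h4 : bits_of k0 = Blank by case: (bits_of k0) h3.
  have H j : (k0 + j < R)%N -> bits_of (k0 + j)%N = Blank.
    elim: j => [|j IH] hj; first by rewrite addn0.
    have := hhor 0%N (s0 + l + (k0 + j))%N Tn_gt0; rewrite /hor_ok => /(_ ltac:(lia)) /and3P[_ _ /implyP].
    rewrite -/(bits_of (k0 + j)%N) IH /=; last by lia.
    by rewrite leq_addr eqxx addnS /bits_of addnS => /(_ isT) /eqP.
  by rewrite -(subnKC h1); apply: H; lia.
have hw : size w = k0 by rewrite size_map size_iota.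
have hsz : size (pair_enc x w) = (l + k0)%N by rewrite pair_enc_cat size_cat hw.
have hrow t s : (t < Tn)%N -> (s < W)%N -> y t s = row w t s%:Z.
  elim: t s => [|t IH] s ht hs.
    have /and4P[_ _ /implyP/(_ isT) h1 _] := hself 0%N s ht hs.
    apply: (init_ok_inj h1 (row_init w s)) => h2.
    have hs' : s = (s0 + l + (s - (s0 + l)))%N by lia.
    rewrite -/(y 0%N s); case: (ltnP s (s0 + l + k0)) => h3; last first.
      rewrite row_sym_end ?hsz //; last by lia.
      by rewrite hs'; apply: hbl; rewrite /R; lia.
    rewrite row_sym_in ?hsz //; try lia.
    rewrite pair_enc_cat nth_cat ifF; last by lia.
    rewrite (nth_map 0%N) ?size_iota; last by lia.
    rewrite nth_iota; last by lia.
    have := hin (s - (s0 + l))%N ltac:(lia).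
    rewrite (_ : (0 + (s - s0 - l) = s - (s0 + l))%N); last by lia.
    have -> : csym (y 0%N s) = bits_of (s - (s0 + l))%N by rewrite /bits_of -hs'.
    by case: (bits_of _).
  have ht' : (t < Tn)%N by lia.
  rewrite row_step /y; move/eqP: (hver t s ht hs) => ->; rewrite -/(y t s) IH //.
  have hp := ic_pos w t.
  have -> z : ca_rule (tick t) (tl_left (A t s)) (row w t s%:Z) z = ca_rule (tick t) (row w t (s%:Z - 1)) (row w t s%:Z) z.
    (* Column 0 has no left neighbour to compare with; [self_ok] says that neither head nor marker
       enters there, as is the case in the true row. *)
    case: s hs => [|s] hs.
      have /and4P[/implyP/(_ isT)/andP[/eqP h1 h2] _ _ _] := hself t 0%N ht' hs.
      apply: ca_rule_left; first by rewrite /going_right h1 /row /marked_cell /chead /= ifF //; lia.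
      by rewrite (negbTE h2) /row /marked_cell /cmark /mpos /=; lia.
    have /and3P[/eqP <- _ _] := hhor t s ht' hs.
    by rewrite -/(y t s) IH //; [congr (ca_rule _ (row _ _ _)); lia | lia].
  apply: ca_rule_right.
  (* At the last column only a head could enter from the right, which [self_ok] excludes for the
     tile and [ic_pos] for the true row. *)
  case: (ltnP s.+1 W) => hs1.
    have /and3P[_ /eqP -> _] := hhor t s ht' hs1.
    by rewrite -/(y t s.+1) IH //; congr (going_left (row _ _ _)); lia.
  have /and4P[_ /implyP hz _ _] := hself t s ht' hs.
  rewrite /going_left (eqP (hz _)); last by lia.
  by rewrite /row /marked_cell /chead /= ifF //; lia.
have hT : (Tn.-1 < Tn)%N by lia.
have hfin s : (s < W)%N -> final_ok (A Tn.-1 s).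
  by move=> hs; have /and4P[_ _ _ /implyP/(_ (eqxx _))] := hself Tn.-1 s hT hs.
have hsw : (size w <= ticks Tn.-1)%N.
  rewrite hw leqNgt; apply/negP => hgt.
  (* The marker stops just before this column, so a longer witness would still have a pending bit in
     it. *)
  have /andP[+ _] := hfin (s0 + l + ticks Tn.-1)%N ltac:(lia).
  rewrite -/(y _ _) hrow //; last by lia.
  by rewrite /row /marked_cell /cpend /= /mpos hsz; lia.
exists w; split=> //; apply/(accept_row hsw).
have hp := ic_pos w Tn.-1.
pose s := absz (ic w Tn.-1).1.2.
have hs : s%:Z = (ic w Tn.-1).1.2 by rewrite /s; lia.
have /andP[_] := hfin s ltac:(lia).
have /and3P[_ /eqP -> _] := hhor Tn.-1 s hT ltac:(lia).
rewrite -/(y _ _) -/(y _ s.+1) !hrow //; try lia.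
rewrite /row /marked_cell /chead /csym /= hs eqxx.
have -> : s.+1%:Z = (ic w Tn.-1).1.2 + 1 by lia.
case: (ic w Tn.-1) => [[q p] T] /= /and3P[h1 /eqP h2 h3].
by rewrite /istep; case: (d q (T p)) h1.
Qed.

Theorem tiling_iff : (exists A, tiling A) <->
  exists w, (size w <= ticks Tn.-1)%N /\ tm_outputs V (pair_enc x w) [:: true].
Proof.
split; first by case=> A; exact: tiling_sound.
by case=> w [h1 h2]; eexists; exact: (tiling_complete h1 h2).
Qed.

End Automaton.

(** * Choice problems as LPCCs *)

Definition vec_of n (f : nat -> int) : 'cV[int]_n := \col_(i < n) f i.
Definition mat_of n (f : nat -> nat -> int) : 'M[int]_n := \matrix_(i < n, j < n) f i j.

Section ConflictLPCC.
Variables (n : nat) (valid : nat -> bool) (cellof : nat -> nat) (conf : nat -> nat -> bool).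

(** Variable 0 is the coordinate z to be maximized. The same vector serves as objective and as [lq],
    where it makes the slack of row 0 equal to [1 - z]. *)
Definition first_entry (i : nat) : int := (i == 0%N)%:R.
(** A valid row reads: z is at most the sum of the variables in the group of [i]. The other rows
    read [0 >= 0]. *)
Definition cover_entry (i j : nat) : int :=
  if valid i then (if j == 0%N then -1 else (valid j && (cellof j == cellof i))%:R) else 0.
Definition conflict_entry (i j : nat) : int :=
  if i == 0%N then - (j == 0%N)%:R else [&& valid i, valid j & conf i j]%:R.

Definition conflict_lpcc : lpcc := {| lp_dim := n;
  lc := vec_of n first_entry; ld := vec_of n (fun=> 0); lb := vec_of n (fun=> 0); lq := vec_of n first_entry;
  lB := mat_of n cover_entry; lC := mat_of n (fun _ _ => 0);
  lM := mat_of n conflict_entry; lN := mat_of n (fun _ _ => 0) |}.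

Lemma conflict_lpcc_binary : binary conflict_lpcc.
Proof.
split=> [i|i j] /=; rewrite ?mxE; split=> //; rewrite /first_entry /cover_entry /conflict_entry.
- by case: (_ == _).
- by case: (_ == _).
- by case: (valid _) => //; case: (nat_of_ord j == _) => //; case: (_ && _).
- by case: (nat_of_ord i == _); [case: (_ == _) | case: [&& _, _ & _]].
Qed.

Hypothesis n_gt0 : (0 < n)%N.
Hypothesis valid0 : valid 0 = false.
Variable R : realType.
Let o0 : 'I_n := Ordinal n_gt0.

(** The case [i = j] is included: an index in conflict with itself can never be chosen. *)
Definition choosable : Prop := exists S : nat -> bool,
  (forall i, (i < n)%N -> valid i -> exists j, [/\ (j < n)%N, S j, valid j & cellof j = cellof i]) /\
  (forall i j, (i < n)%N -> (j < n)%N -> valid i -> valid j -> S i -> S j -> conf i j = false).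

Let w (x y : 'cV[R]_n) (i : 'I_n) : R :=
  (rmx R (lM conflict_lpcc) *m x + rmx R (lN conflict_lpcc) *m y + rmx R (lq conflict_lpcc)) i ord0.

Lemma wE x y i : w x y i =
  if i == o0 then 1 - x o0 ord0 else \sum_(j < n) [&& valid i, valid j & conf i j]%:R * x j ord0.
Proof.
rewrite /w !mxE [X in _ + X + _]big1 ?addr0; last by move=> j _; rewrite !mxE mul0r.
have e0 (j : 'I_n) : (j == o0) = (j == 0%N :> nat) by [].
case: (i =P o0) => [->|/eqP hi].
  rewrite /first_entry /= addrC (bigD1 o0) //= big1 ?addr0; last first.
    move=> j hj; rewrite !mxE /conflict_entry /=; move: hj; rewrite e0 => /negbTE ->.
    by rewrite oppr0 mul0r.
  by rewrite !mxE /conflict_entry /= rmorphN rmorph1 mulN1r.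
have hi0 : (i == 0%N :> nat) = false by rewrite -e0 (negbTE hi).
rewrite /first_entry hi0 addr0; apply: eq_bigr => j _; rewrite !mxE /conflict_entry hi0.
by rewrite rmorph_nat.
Qed.

Lemma coverE (x y : 'cV[R]_n) i :
  (rmx R (lB conflict_lpcc) *m x + rmx R (lC conflict_lpcc) *m y) i ord0 =
  if valid i then \sum_(j < n) (valid j && (cellof j == cellof i))%:R * x j ord0 - x o0 ord0 else 0.
Proof.
rewrite !mxE [X in _ + X]big1 ?addr0; last by move=> j _; rewrite !mxE mul0r.
case hv: (valid i); last by apply: big1 => j _; rewrite !mxE /cover_entry hv mul0r.
rewrite (bigD1 o0) //= [in RHS](bigD1 o0) //= valid0 mul0r add0r.
rewrite !mxE /cover_entry hv /= rmorphN rmorph1 mulN1r addrC; congr (_ + _).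
apply: eq_bigr => j hj; rewrite !mxE hv.
have -> : (j == 0%N :> nat) = false by apply/negbTE.
by rewrite rmorph_nat.
Qed.

Lemma objE (x y : 'cV[R]_n) : @lpcc_obj R conflict_lpcc x y = x o0 ord0.
Proof.
rewrite /lpcc_obj (bigD1 o0) //= big1 ?addr0 => [|j hj]; rewrite !mxE mul0r addr0.
  by rewrite mul1r.
have -> : first_entry j = 0 by rewrite /first_entry (_ : (j == 0%N :> nat) = false) //; apply/negbTE.
by rewrite mul0r.
Qed.

Lemma feasible_compl x y i : @lpcc_feasible R conflict_lpcc x y -> x i ord0 * w x y i = 0.
Proof.
move=> [_ hw hx hs]; move/eqP: hs; rewrite psumr_eq0 => [/allP h|j _].
  by apply/eqP; apply: h; rewrite mem_index_enum.
by apply: mulr_ge0; [exact: hx | exact: hw].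
Qed.

Lemma feasible_values x y : @lpcc_feasible R conflict_lpcc x y ->
  x o0 ord0 = 0 \/ x o0 ord0 = 1.
Proof.
move=> hf; have := feasible_compl o0 hf; rewrite wE eqxx => /eqP.
by rewrite mulf_eq0 subr_eq0 => /orP[/eqP ->|/eqP <-]; [left | right].
Qed.

Lemma value0 : @lpcc_values R conflict_lpcc 0.
Proof.
exists 0, 0; split; last by rewrite objE mxE.
split=> [i|i|i|].
- by rewrite coverE !mxE; case: valid => //; rewrite big1 ?subrr // => j _; rewrite mxE mulr0.
- rewrite -/(w 0 0 i) wE; case: eqP => _; first by rewrite mxE subr0.
  by rewrite big1 // => j _; rewrite mxE mulr0.
- by rewrite mxE.
- by rewrite big1 // => i _; rewrite mxE mul0r.
Qed.

(** For z = 1 the cover rows give every group a positive variable, and complementarity keeps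
    conflicting variables from being positive together, so the support of [x] is a choice.
    Conversely, the indicator vector of a choice, with z = 1, is feasible. *)
Lemma value1P : @lpcc_values R conflict_lpcc 1 <-> choosable.
Proof.
split.
  move=> [x [y [hf]]]; rewrite objE => hx1.
  have [hB hw hx _] := hf.
  (* [insub] extends the support of [x] from ordinals to all natural numbers. *)
  exists (fun j => if insub j is Some j' then 0 < x (j' : 'I_n) ord0 else false); split.
    move=> i hi hv; have := hB (Ordinal hi); rewrite coverE /= hv !mxE -hx1 => hge.
    have hpos : 0 < \sum_(j < n) (valid (j : 'I_n) && (cellof j == cellof i))%:R * x j ord0 by lra.
    have [j /andP[/andP[h1 /eqP h2] h3]] : exists j : 'I_n, (valid j && (cellof j == cellof i)) && (0 < x j ord0).
      apply/existsP; apply: contraTT hpos; rewrite negb_exists => /forallP h.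
      rewrite -leNgt big1 // => j _; have := h j; case: (_ && (cellof _ == _)) => /=; last by rewrite mul0r.
      by rewrite -leNgt => hle; rewrite mul1r; apply/eqP; rewrite eq_le hle hx.
    by exists j; split=> //; rewrite ?valK.
  move=> i j hi hj hvi hvj; rewrite !insubT => h1 h2; apply/negbTE/negP => hc.
  have := feasible_compl (Ordinal hi) hf; rewrite wE ifF; last first.
    by apply/eqP => /(congr1 val) /= e; rewrite e valid0 in hvi.
  move=> /eqP; rewrite mulf_eq0 gt_eqF //= psumr_eq0 => [/allP/(_ (Ordinal hj))|k _]; last first.
    by apply: mulr_ge0.
  by rewrite mem_index_enum /= hvi hvj hc mul1r gt_eqF // => /(_ isT).
move=> [S [hS1 hS2]].
pose x : 'cV[R]_n := \col_i (if i == o0 then 1 else (S i && valid i)%:R).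
have xE (j : 'I_n) : j != o0 -> x j ord0 = (S j && valid j)%:R by rewrite mxE => /negbTE ->.
have x0 : x o0 ord0 = 1 by rewrite mxE eqxx.
have xge j : 0 <= x j ord0 by rewrite mxE; case: eqP.
have wx (i : 'I_n) : i != o0 -> 0 <= w x 0 i /\ x i ord0 * w x 0 i = 0.
  move=> hi; rewrite wE (negbTE hi); split; first by apply: sumr_ge0 => j _; apply: mulr_ge0.
  rewrite xE //; case: (boolP (S i && valid i)) => [/andP[h1 h2]|_]; last by rewrite mul0r.
  rewrite mul1r big1 // => j _; case: (boolP [&& _, _ & _]) => [/and3P[_ h3 h4]|]; last by rewrite mul0r.
  rewrite mul1r xE; last by apply/eqP => e; rewrite e valid0 in h3.
  case: (boolP (S j && _)) => // /andP[h5 _].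
  by rewrite (hS2 i j) in h4.
have w0 : w x 0 o0 = 0 by rewrite wE eqxx x0 subrr.
exists x, 0; split; last by rewrite objE x0.
split=> // [i|i|].
- rewrite coverE x0 !mxE; case hv : (valid i) => //.
  have [j [hj hSj hvj hc]] := hS1 i (ltn_ord i) hv.
  rewrite (bigD1 (Ordinal hj)) //= hvj hc eqxx mul1r xE /=; last first.
    by apply/eqP => /(congr1 val) /= e; rewrite e valid0 in hvj.
  by rewrite hSj hvj /= addrAC subrr add0r sumr_ge0 // => k _; apply: mulr_ge0.
- by rewrite -/(w x 0 i); case: (i =P o0) => [->|/eqP /wx []]; rewrite ?w0.
- apply: big1 => i _; rewrite -/(w x 0 i).
  by case: (i =P o0) => [->|/eqP /wx []]; rewrite ?w0 ?mulr0.
Qed.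

Lemma values_01 v : @lpcc_values R conflict_lpcc v -> v = 0 \/ v = 1.
Proof. by move=> [x [y [hf ->]]]; rewrite objE; exact: feasible_values hf. Qed.

Lemma conflict_lpcc_bounded : lpcc_bounded R conflict_lpcc.
Proof.
split; first by exists 0; exact: value0.
by exists 1 => v /values_01 [->|->].
Qed.

Lemma conflict_lpcc_opt1 : choosable -> lpcc_opt R conflict_lpcc = 1.
Proof.
move=> h; have h1 := (iffRL value1P) h; apply/eqP; rewrite eq_le; apply/andP; split.
  by apply: ge_sup; [exists 0; exact: value0 | move=> v /values_01 [->|->]].
by apply: ub_le_sup => //; have [] := conflict_lpcc_bounded.
Qed.

Lemma conflict_lpcc_opt0 : ~ choosable -> lpcc_opt R conflict_lpcc = 0.
Proof.
move=> h; have h1 v : @lpcc_values R conflict_lpcc v -> v = 0.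
  by move=> hv; case: (values_01 hv) => // e; case: h; apply/value1P; rewrite -e.
rewrite /lpcc_opt (_ : @lpcc_values R conflict_lpcc = [set 0]%classic) ?sup1 //.
by apply/seteqP; split=> [v /h1 -> //|v ->]; exact: value0.
Qed.

End ConflictLPCC.

(** * Digits *)

Section Digits.
Variable l : nat.
Hypothesis l_gt1 : (1 < l)%N.
Let l_gt0 : (0 < l)%N := ltnW l_gt1.

(** The number formed by the [c] digits of [N] from position [o] on. *)
Definition num (N o c : nat) : nat := (N %/ l ^ o %% l ^ c)%N.

Lemma num_lt N o c : (num N o c < l ^ c)%N.
Proof. by rewrite ltn_pmod // expn_gt0 l_gt0. Qed.

Lemma dg_lt N a : (dg l N a < l)%N.
Proof. by rewrite ltn_pmod. Qed.

Lemma num_num N o C o' c : (o' + c <= C)%N -> num (num N o C) o' c = num N (o + o') c.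
Proof.
move=> h; rewrite /num expnD divnMA; set M := (N %/ l ^ o)%N.
have -> : (l ^ C = l ^ (C - o') * l ^ o')%N by rewrite -expnD subnK //; lia.
by rewrite -modn_divl modn_dvdm // dvdn_exp2l //; lia.
Qed.

Lemma dg_num N o c a : (a < c)%N -> dg l (num N o c) a = dg l N (o + a).
Proof. by move=> h; have := @num_num N o c a 1; rewrite addn1 /num expn1 => /(_ h). Qed.

Lemma dg_small N c : (N < l ^ c.+1)%N -> dg l N c = (N %/ l ^ c)%N.
Proof. by move=> h; rewrite /dg modn_small // ltn_divLR ?expn_gt0 ?l_gt0 // -expnS. Qed.

Lemma dg_mod N c a : (a < c)%N -> dg l (N %% l ^ c) a = dg l N a.
Proof. by move=> h; have := @dg_num N 0 c a h; rewrite /num divn1 add0n. Qed.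

Lemma dg_inj c u v : (u < l ^ c)%N -> (v < l ^ c)%N ->
  (forall a, (a < c)%N -> dg l u a = dg l v a) -> u = v.
Proof.
elim: c u v => [|c IH] u v hu hv h; first by move: hu hv; rewrite expn0; case: u {h} => //; case: v.
rewrite (divn_eq u (l ^ c)) (divn_eq v (l ^ c)) -!dg_small // h //.
congr (_ + _)%N; apply: IH; rewrite ?ltn_pmod ?expn_gt0 ?l_gt0 // => a ha.
by rewrite !dg_mod // h //; lia.
Qed.

Lemma dg0 a : dg l 0 a = 0%N.
Proof. by rewrite /dg div0n mod0n. Qed.

Lemma eq_digits c u v : (u < l ^ c)%N -> (v < l ^ c)%N ->
  (u == v) = [forall a : 'I_c, dg l u a == dg l v a].
Proof.
move=> hu hv; apply/eqP/forallP => [-> a //|h]; apply: (dg_inj hu hv) => a ha.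
exact/eqP/(h (Ordinal ha)).
Qed.

Lemma zero_digits c u : (u < l ^ c)%N -> (u == 0%N) = [forall a : 'I_c, dg l u a == 0%N].
Proof.
move=> hu; rewrite (eq_digits hu) ?expn_gt0 ?l_gt0 //.
by apply: eq_forallb => a; rewrite dg0.
Qed.

Lemma last_digits c u : (u < l ^ c)%N -> (u == (l ^ c).-1) = [forall a : 'I_c, dg l u a == l.-1].
Proof.
move=> hu; rewrite dg_last //; have : (0 < l ^ c)%N by rewrite expn_gt0 l_gt0.
lia.
Qed.

(** The odometer rule, with the overflow excluded: the maximal [u] would wrap around to 0 instead of
    reaching its successor. *)
Lemma succ_digits c u v : (u < l ^ c)%N -> (v < l ^ c)%N ->
  (v == u.+1) = [forall a : 'I_c, if [forall b : 'I_a, dg l u b == l.-1] then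
      (if dg l u a == l.-1 then dg l v a == 0%N else dg l v a == (dg l u a).+1)
      else dg l u a == dg l v a] && ~~ [forall a : 'I_c, dg l u a == l.-1].
Proof.
move=> hu hv; rewrite dg_last //.
have E : [forall a : 'I_c, if [forall b : 'I_a, dg l u b == l.-1] then
      (if dg l u a == l.-1 then dg l v a == 0%N else dg l v a == (dg l u a).+1)
      else dg l u a == dg l v a] = [forall a : 'I_c, dg l v a == dg l u.+1 a].
  apply: eq_forallb => a; rewrite dg_succ //; case: [forall _, _]; last by rewrite [RHS]eq_sym.
  by case: ifP.
rewrite E; have := hu; rewrite leq_eqVlt => /orP[/eqP e|hlt].
  by rewrite e eqxx andbF; apply/eqP; lia.
by rewrite -(eq_digits hv hlt) (ltn_eqF hlt) andbT.
Qed.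

Lemma dg_single c r a : (r < c)%N -> dg l ((l.-1) * l ^ r) a = if a == r then l.-1 else 0%N.
Proof.
move=> hr; rewrite /dg; case: (ltngtP a r) => h.
- have -> : (l.-1 * l ^ r = l * (l.-1 * l ^ (r - a.+1)) * l ^ a)%N.
    by rewrite -{1}(subnK h) expnD expnS; lia.
  by rewrite mulnK ?expn_gt0 ?l_gt0 // modnMr.
- rewrite divn_small ?mod0n //; apply: leq_trans (_ : l ^ r.+1 <= _)%N; last by rewrite leq_exp2l.
  by rewrite expnS ltn_mul2r expn_gt0 l_gt0 /=; lia.
- by rewrite h mulnK ?expn_gt0 ?l_gt0 // modn_small; lia.
Qed.

Lemma flatten_iota_mul (T : Type) (g : nat -> seq T) a b : (0 < b)%N ->
  flatten [seq g N | N <- iota 0 (a * b)] =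
  flatten [seq flatten [seq g (i * b + j)%N | j <- iota 0 b] | i <- iota 0 a].
Proof.
move=> hb; elim: a => [|a IH] //.
rewrite mulSn addnC iotaD map_cat flatten_cat IH -[in RHS]addn1 iotaD map_cat flatten_cat /= cats0.
congr (_ ++ flatten _); rewrite !add0n -[X in iota X _](addn0 (a * b)) iotaDl -map_comp.
by [].
Qed.

(** The marks recognise the digits 0 and [l.-1] for every base [l], so these two act as bits, giving
    a number of phases independent of [l]. *)
Definition binary_digits c u : bool := [forall b : 'I_c, (dg l u b == 0%N) || (dg l u b == l.-1)].
Definition bin_value c u : nat := (\sum_(b < c) (dg l u b == l.-1) * 2 ^ b)%N.

(** Numbers with binary digits are ordered as their binary values, so counting through all of
    [l ^ c] and skipping the others visits the phases in order. *)
Lemma flatten_binary (T : Type) c (g : nat -> seq T) :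
  flatten [seq (if binary_digits c u then g (bin_value c u) else [::]) | u <- iota 0 (l ^ c)] =
  flatten [seq g p | p <- iota 0 (2 ^ c)].
Proof.
elim: c g => [|c IH] g.
  rewrite /= /bin_value big_ord0 (_ : binary_digits 0 0) //.
  by apply/forallP; case.
have hlc : (0 < l ^ c)%N by rewrite expn_gt0 l_gt0.
rewrite expnS flatten_iota_mul //.
(* [E d] is the contribution of all numbers whose top digit is [d]. *)
pose E d : seq T := if (d == 0%N) || (d == l.-1) then
  flatten [seq g ((d == l.-1) * 2 ^ c + p)%N | p <- iota 0 (2 ^ c)] else [::].
have -> : [seq flatten [seq (if binary_digits c.+1 (i * l ^ c + j) then
     g (bin_value c.+1 (i * l ^ c + j)) else [::]) | j <- iota 0 (l ^ c)] | i <- iota 0 l] =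
   [seq E i | i <- iota 0 l].
  apply/eq_in_map => d; rewrite mem_iota => /andP[_ hd].
  have Hd r : (r < l ^ c)%N -> dg l (d * l ^ c + r) c = d.
    by move=> hr; rewrite /dg divnMDl // (divn_small hr) addn0 modn_small.
  have Hr r a : (r < l ^ c)%N -> (a < c)%N -> dg l (d * l ^ c + r) a = dg l r a.
    by move=> hr ha; rewrite -(@dg_mod (_ + _) c) // modnMDl dg_mod.
  have Hb r : (r < l ^ c)%N -> binary_digits c.+1 (d * l ^ c + r) =
      ((d == 0%N) || (d == l.-1)) && binary_digits c r.
    move=> hr; apply/forallP/andP => [h|[h1 /forallP h2] a].
      split; first by have := h ord_max; rewrite /= Hd.
      by apply/forallP => a; have := h (widen_ord (leqnSn c) a); rewrite /= Hr.
    have := ltn_ord a; rewrite ltnS leq_eqVlt => /orP[/eqP ->|ha]; first by rewrite Hd.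
    by rewrite Hr //; exact: (h2 (Ordinal ha)).
  have Hv r : (r < l ^ c)%N -> bin_value c.+1 (d * l ^ c + r) = ((d == l.-1) * 2 ^ c + bin_value c r)%N.
    move=> hr; rewrite /bin_value big_ord_recr /= Hd // addnC; congr (_ + _)%N.
    by apply: eq_bigr => a _; rewrite Hr.
  rewrite /E -(IH (fun p => g ((d == l.-1) * 2 ^ c + p)%N)).
  case: ifP => h; last first.
    rewrite (_ : [seq _ | j <- _] = [seq [::] | j <- iota 0 (l ^ c)]).
      by elim: (iota _ _).
    by apply/eq_in_map => r; rewrite mem_iota => /andP[_ hr]; rewrite Hb // h.
  by congr flatten; apply/eq_in_map => r; rewrite mem_iota => /andP[_ hr]; rewrite Hb // h Hv.
have -> : flatten [seq E i | i <- iota 0 l] = E 0%N ++ E l.-1.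
  (* Only the first and the last digit contribute; they are distinct because [1 < l]. *)
  have -> : iota 0 l = (0%N :: iota 1 l.-2) ++ [:: l.-1].
    by rewrite -[LHS](cat_take_drop l.-1) take_iota drop_iota (minn_idPl _) ?leq_pred //
      (_ : l - l.-1 = 1)%N ?add0n; [case: (l) l_gt1 => [|[|m]] | lia].
  rewrite map_cat flatten_cat /= cats0 -catA; congr (_ ++ _).
  rewrite (_ : [seq E i | i <- iota 1 l.-2] = [seq [::] | i <- iota 1 l.-2]).
    by elim: (iota _ _).
  by apply/eq_in_map => r; rewrite mem_iota /E => hr; rewrite ifF //; lia.
have e0 : (0%N == l.-1) = false by lia.
have e1 : (l.-1 == 0%N) = false by lia.
rewrite /E !eqxx e0 e1 /= !mul1n.
rewrite expnS mul2n -addnn iotaD map_cat flatten_cat add0n; congr (_ ++ flatten _).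
have -> : iota (2 ^ c)%N (2 ^ c)%N = map (addn (2 ^ c)%N) (iota 0 (2 ^ c)%N) by rewrite -iotaDl addn0.
by rewrite -map_comp.
Qed.

End Digits.

(** * Facts about the digits that can be read off pairs of consecutive letters *)

Section Atoms.
Variables (K : nat).
Notation P := (bool * bool)%type.
Notation bgset := (bset P K).
Notation msymb := (msym P K).

Record atoms := Atoms { at_first : 'I_K -> bool; at_last : 'I_K -> bool;
  at_bit : 'I_K -> bool; at_flag : 'I_K -> bool;
  at_eq : 'I_K -> 'I_K -> bool; at_succ : 'I_K -> 'I_K -> bool }.

Definition atoms_of (Z : bgset) (pv : option msymb) : atoms := {|
  at_first := fun a => [exists z, [&& Z z, z.1 == None & z.2.2 a]];
  at_last := fun a => if pv is Some v then v.2 a else false;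
  at_bit := fun a => [exists z, [&& Z z, z.2.2 a & z.2.1.1]];
  at_flag := fun a => [exists z, [&& Z z, z.2.2 a & z.2.1.2]];
  at_eq := fun a b => [exists z, [&& Z z, z.2.2 a & z.2.2 b]];
  at_succ := fun a b => [exists z, [&& Z z, (if z.1 is Some y then y.2 a else false) & z.2.2 b]] |}.

Variable v : seq P.
Notation l := (size v).
Hypothesis l_gt1 : (1 < l)%N.
Local Notation p0 := (false, false).

Definition num_atoms (N : nat) : atoms := {|
  at_first := fun a => dg l N a == 0%N;
  at_last := fun a => dg l N a == l.-1;
  at_bit := fun a => (nth p0 v (dg l N a)).1;
  at_flag := fun a => (nth p0 v (dg l N a)).2;
  at_eq := fun a b => dg l N a == dg l N b;
  at_succ := fun a b => dg l N b == (dg l N a).+1 |}.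

Lemma mem_bigrams (m : nat -> {ffun 'I_K -> bool}) z :
  reflect (exists2 i, (i < l)%N & z = (if i is i'.+1 then Some (nth p0 v i', m i') else None, (nth p0 v i, m i)))
    (z \in bigrams (None : option msymb) (marked p0 v m 0 l)).
Proof.
suff H k j : reflect (exists2 i, (j <= i < j + k)%N & z = (if i is i'.+1 then Some (nth p0 v i', m i') else None, (nth p0 v i, m i)))
    (z \in bigrams (if j is j'.+1 then Some (nth p0 v j', m j') else None : option msymb) (marked p0 v m j k)).
  exact: (H l 0%N).
elim: k j => [|k IH] j /=.
  by rewrite in_nil; apply: ReflectF => -[i hi]; lia.
rewrite in_cons; apply: (iffP orP) => [[/eqP ->|/(IH j.+1) [i hi ->]]|[i hi e]].
- by exists j => //; lia.
- by exists i => //; lia.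
case: (eqVneq i j) => [ij|ne]; first by left; rewrite e ij.
by right; apply/(IH j.+1); exists i => //; lia.
Qed.

(** Each digit marks exactly one letter, so the existence of a pair with given marks speaks about
    that position: equal digits share a letter, consecutive digits form a pair, and the letter gives
    the bit and the flag. *)
Lemma atomsE N :
  atoms_of [ffun z => z \in bigrams None (marked p0 v (dmarks K v N) 0 l)]
    (Some (nth p0 v l.-1, dmarks K v N l.-1)) = num_atoms N.
Proof.
have ex (Q : option msymb * msymb -> bool) (b : bool) :
  (forall i, (i < l)%N -> Q (if i is i'.+1 then Some (nth p0 v i', dmarks K v N i') else None, (nth p0 v i, dmarks K v N i)) -> b) ->
  (b -> exists2 i, (i < l)%N & Q (if i is i'.+1 then Some (nth p0 v i', dmarks K v N i') else None, (nth p0 v i, dmarks K v N i))) ->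
  [exists z, [ffun z => z \in bigrams None (marked p0 v (dmarks K v N) 0 l)] z && Q z] = b.
  move=> h1 h2; apply/existsP/idP => [[z]|/h2 [i hi hq]].
    by rewrite ffunE => /andP[/mem_bigrams [i hi ->]]; exact: h1.
  eexists; rewrite ffunE; apply/andP; split; last exact: hq.
  by apply/mem_bigrams; exists i.
have l0 : (0 < l)%N by lia.
have hd a := @dg_lt l l_gt1 N a.
rewrite /atoms_of /num_atoms; congr Atoms.
- apply: funext => a; apply: (ex (fun z => (z.1 == None) && z.2.2 a)) => [[|i] hi //|h].
    by rewrite /= ffunE.
  by exists 0%N; rewrite //= ffunE.
- by apply: funext => a; rewrite ffunE.
- apply: funext => a; apply: (ex (fun z => z.2.2 a && z.2.1.1)) => [i hi /=|h].
    by rewrite ffunE => /andP[/eqP -> ].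
  by exists (dg l N a); rewrite //= ffunE eqxx.
- apply: funext => a; apply: (ex (fun z => z.2.2 a && z.2.1.2)) => [i hi /=|h].
    by rewrite ffunE => /andP[/eqP -> ].
  by exists (dg l N a); rewrite //= ffunE eqxx.
- apply: funext => a; apply: funext => b; apply: (ex (fun z => z.2.2 a && z.2.2 b)) => [i hi /=|h].
    by rewrite !ffunE => /andP[/eqP -> /eqP ->].
  by exists (dg l N a); rewrite //= !ffunE eqxx eq_sym.
- apply: funext => a; apply: funext => b.
  apply: (ex (fun z => (if z.1 is Some y then y.2 a else false) && z.2.2 b)) => [[|i] hi //=|/eqP h].
    by rewrite !ffunE => /andP[/eqP -> /eqP ->].
  (* Digit [b] is a successor here, so the pair ending at its position has a first letter. *)
  by exists (dg l N b); rewrite ?h //= -?h // !ffunE h !eqxx.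
Qed.

End Atoms.

(** * The instance and its encoding *)

Section Instance.
Variables (V : TM) (k Dt : nat).
Local Notation p0 := (false, false).

(* An index below [l ^ D] has, from low to high, [Nt] one-hot digits for the tile, [Ds] for the column
   and [Dt] for the row; a loop counter holds a column index, a row index and four phase digits. *)
Definition Nt : nat := #|tile V|.
Definition Ds : nat := Dt.+2.
Definition D : nat := (Nt + (Ds + Dt))%N.
Definition K : nat := (D + D + 3).+1.
Definition tr (a : nat) : 'I_K := inord a.

Lemma tr_val a : (a < K)%N -> tr a = a :> nat.
Proof. exact: inordK. Qed.

Section Numeric.
Variable x : seq bool.
Let v := base_word x.
Let l := size v.

(** A one-hot number: the digit of rank [enum_rank a] is maximal and the others are 0, which the
    marks can test. *)
Definition tcode (a : tile V) : nat := (l.-1 * l ^ enum_rank a)%N.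
(** The least column whose top digit is maximal. It leaves at least [l ^ Dt] columns on its left and
    [l ^ Dt.+1] from it on, enough for [l ^ Dt] rows. *)
Definition start_col : nat := (l.-1 * l ^ Dt.+1)%N.
(** The low [k] digits are flagged and the others are 0, which holds for exactly [(size x).+2 ^ k]
    row numbers when [k <= Dt]. *)
Definition ticking (t : nat) : bool :=
  [forall a : 'I_k, (nth p0 v (dg l t a)).2] && [forall a : 'I_Dt, (k <= a)%N ==> (dg l t a == 0%N)].
Definition scol (i : nat) : nat := num l i Nt Ds.
Definition trow (i : nat) : nat := num l i (Nt + Ds) Dt.
Definition scell (i : nat) : nat := num l i Nt (Ds + Dt).
Definition has_tile (i : nat) (a : tile V) : bool := num l i 0 Nt == tcode a.
Definition valid_idx (i : nat) : bool := [exists a, has_tile i a].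
(** Different tiles of one cell need not clash: from several compatible choices any one can be kept.
    A tile that violates [self_ok] clashes with every choice, itself included. *)
Definition clash (i j : nat) (a b : tile V) : bool :=
  [|| ~~ self_ok x start_col (l ^ Ds) (l ^ Dt) (trow i) (scol i) a,
      [&& trow i == trow j, scol j == (scol i).+1 & ~~ hor_ok x start_col (trow i) (scol i) a b]
    | [&& trow j == (trow i).+1, scol i == scol j & ~~ ver_ok ticking (trow i) a b]].
Definition conf_idx (i j : nat) : bool :=
  [exists a, exists b, [&& has_tile i a, has_tile j b & clash i j a b]].

End Numeric.

(** * The same predicates as formulas over digit facts *)

Section Formulas.
Variable A : atoms K.

Definition fzero (o c : nat) : bool := [forall a : 'I_c, at_first A (tr (o + a))].
Definition fmax (o c : nat) : bool := [forall a : 'I_c, at_last A (tr (o + a))].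
Definition feq (o o' c : nat) : bool := [forall a : 'I_c, at_eq A (tr (o + a)) (tr (o' + a))].
Definition fsucc (o o' c : nat) : bool :=
  [forall a : 'I_c, if fmax o a then
     (if at_last A (tr (o + a)) then at_first A (tr (o' + a)) else at_succ A (tr (o + a)) (tr (o' + a)))
     else at_eq A (tr (o + a)) (tr (o' + a))] && ~~ fmax o c.
Definition ftile (o : nat) (a : tile V) : bool :=
  [forall b : 'I_Nt, if b == enum_rank a :> nat then at_last A (tr (o + b)) else at_first A (tr (o + b))].
Definition fvalid (o : nat) : bool := [exists a, ftile o a].

Definition init_b (before inbase isstart isend bit : bool) (y : cell V) : bool :=
  if before then y == (None, Blank, false, false)
  else if inbase then y == ((if isstart then Some ord0 else None), bitsym bit, isend, false)
  else [&& chead y == None, ~~ cmark y & cpend y == is_bit (csym y)].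

(* [o] is the offset of the digits of the index; its column digits start at [o + Nt]. *)
Definition fbefore (o : nat) : bool := ~~ at_last A (tr (o + Nt + Dt.+1)).
(** In a column from [start_col] on, vanishing middle digits mean an offset below [l]: the cell lies
    in the fixed part and its lowest digit points at its own letter. *)
Definition finbase (o : nat) : bool := [forall a : 'I_Dt, at_first A (tr (o + Nt + a.+1))].
Definition fself (o : nat) (a : tile V) : bool :=
  [&& fzero (o + Nt) Ds ==> (chead (tl_left a) == None) && ~~ cmark (tl_left a),
      fmax (o + Nt) Ds ==> (chead (tl_right a) == None),
      fzero (o + (Nt + Ds)) Dt ==> init_b (fbefore o) (finbase o) (at_first A (tr (o + Nt + 0)))
        (at_last A (tr (o + Nt + 0))) (at_bit A (tr (o + Nt + 0))) (tl_mid a)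
    & fmax (o + (Nt + Ds)) Dt ==> final_ok a].
Definition fhor (o : nat) (a b : tile V) : bool :=
  [&& tl_mid a == tl_left b, tl_right a == tl_mid b &
      fzero (o + (Nt + Ds)) Dt && (~~ fbefore o && ~~ finbase o) && (csym (tl_mid a) == Blank) ==>
      (csym (tl_mid b) == Blank)].
Definition ftick (o : nat) : bool :=
  [forall a : 'I_k, at_flag A (tr (o + (Nt + Ds) + a))] &&
  [forall a : 'I_Dt, (k <= a)%N ==> at_first A (tr (o + (Nt + Ds) + a))].
Definition fver (o : nat) (a b : tile V) : bool :=
  tl_mid b == ca_rule (ftick o) (tl_left a) (tl_mid a) (tl_right a).
Definition fclash (o o' : nat) (a b : tile V) : bool :=
  [|| ~~ fself o a,
      [&& feq (o + (Nt + Ds)) (o' + (Nt + Ds)) Dt, fsucc (o + Nt) (o' + Nt) Ds & ~~ fhor o a b]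
    | [&& fsucc (o + (Nt + Ds)) (o' + (Nt + Ds)) Dt, feq (o + Nt) (o' + Nt) Ds & ~~ fver o a b]].
Definition fconf (o o' : nat) : bool :=
  [exists a, exists b, [&& ftile o a, ftile o' b & fclash o o' a b]].

(** Phases 0 and 1 write the unary dimension and its terminator, 2 to 5 the vectors, each entry once
    at [j = 0], and 6 to 9 the matrices. The remaining phases write nothing. *)
Definition piece (p : nat) (iz jz vi vj same cf : bool) : seq bool :=
  match p with
  | 0 => if jz then [:: true] else [::]
  | 1 => if iz && jz then [:: false] else [::]
  | 2 | 5 => if jz then enc_entry iz%:R else [::]
  | 3 | 4 => if jz then enc_entry 0 else [::]
  | 6 => enc_entry (if vi then (if jz then -1 else (vj && same)%:R) else 0)
  | 7 | 9 => enc_entry 0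
  | 8 => enc_entry (if iz then - jz%:R else [&& vi, vj & cf]%:R)
  | _ => [::]
  end.

Definition fpiece : seq bool :=
  if [forall b : 'I_4, at_first A (tr (D + D + b)) || at_last A (tr (D + D + b))] then
    piece (\sum_(b < 4) at_last A (tr (D + D + b)) * 2 ^ b)%N
      (fzero D D) (fzero 0 D) (fvalid D) (fvalid 0) (feq Nt (D + Nt) (Ds + Dt)) (fconf D 0)
  else [::].

End Formulas.

Section Correct.
Variable x : seq bool.
Let v := base_word x.
Let l := size v.
Let l_gt1 : (1 < l)%N. Proof. by rewrite /l size_base_word. Qed.
Let l_gt0 : (0 < l)%N := ltnW l_gt1.
Local Notation nn := (l ^ D)%N.
Let nn_gt0 : (0 < nn)%N. Proof. by rewrite expn_gt0 l_gt0. Qed.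

(** [base_word x] spells [pair_enc x [::]] in its first components, so one digit in base [l] can
    address any cell of the fixed part. *)
Lemma size_base : size (pair_enc x [::]) = l.
Proof.
rewrite /l size_base_word /pair_enc !size_cat /= addn2; congr _.+2.
by elim: (x) => //= b y ->.
Qed.

Lemma nth_base s : (s < l)%N -> nth false (pair_enc x [::]) s = (nth p0 v s).1.
Proof.
move=> hs; rewrite -(nth_map _ false) //; congr nth.
rewrite /v /base_word map_cat map_flatten -map_comp /pair_enc cats0; congr (_ ++ _).
Qed.

Section Counter.
Variable N : nat.
Local Notation A := (num_atoms K v N).

Lemma fzeroE o c : (o + c <= K)%N -> fzero A o c = (num l N o c == 0%N).
Proof.
move=> h; rewrite (zero_digits l_gt1 (num_lt l_gt1 _ _ _)).
by apply: eq_forallb => a; rewrite /= dg_num // tr_val //; have := ltn_ord a; lia.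
Qed.

Lemma fmaxE o c : (o + c <= K)%N -> fmax A o c = (num l N o c == (l ^ c).-1).
Proof.
move=> h; rewrite (last_digits l_gt1 (num_lt l_gt1 _ _ _)).
by apply: eq_forallb => a; rewrite /= dg_num // tr_val //; have := ltn_ord a; lia.
Qed.

Lemma feqE o o' c : (o + c <= K)%N -> (o' + c <= K)%N ->
  feq A o o' c = (num l N o c == num l N o' c).
Proof.
move=> h h'; rewrite (eq_digits l_gt1 (num_lt l_gt1 _ _ _) (num_lt l_gt1 _ _ _)).
by apply: eq_forallb => a; rewrite /= !dg_num // !tr_val //; have := ltn_ord a; lia.
Qed.

Lemma fsuccE o o' c : (o + c <= K)%N -> (o' + c <= K)%N ->
  fsucc A o o' c = (num l N o' c == (num l N o c).+1).
Proof.
move=> h h'; rewrite (succ_digits l_gt1 (num_lt l_gt1 _ _ _) (num_lt l_gt1 _ _ _)).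
congr (_ && ~~ _).
  apply: eq_forallb => a; have ha := ltn_ord a.
  rewrite /fmax /= !dg_num // !tr_val //; try lia.
  have -> : [forall b : 'I_a, dg l N (tr (o + b)) == l.-1] = [forall b : 'I_a, dg l (num l N o c) b == l.-1].
    apply: eq_forallb => b; have hb := ltn_ord b.
    by rewrite dg_num ?tr_val //; lia.
  by [].
by apply: eq_forallb => a; rewrite /= dg_num // tr_val //; have := ltn_ord a; lia.
Qed.

Lemma tcode_lt (a : tile V) : (tcode x a < l ^ Nt)%N.
Proof.
rewrite /tcode -/v -/l; have := ltn_ord (enum_rank a); rewrite -/Nt => h.
apply: (@leq_trans (l ^ (enum_rank a).+1)%N); last by rewrite leq_exp2l.
by rewrite expnS ltn_mul2r expn_gt0 l_gt0 /=; lia.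
Qed.

Lemma ftileE o a : (o + Nt <= K)%N -> ftile A o a = (num l N o Nt == tcode x a).
Proof.
move=> h; rewrite (eq_digits l_gt1 (num_lt l_gt1 _ _ _) (tcode_lt a)).
apply: eq_forallb => b; have hb := ltn_ord b.
rewrite /= dg_num // !tr_val; try lia.
by rewrite /tcode (@dg_single l l_gt1 Nt) //; case: ifP.
Qed.

Section At.
Variables (o i : nat).
Hypotheses (ho : (o + D <= K)%N) (hi : i = num l N o D).

Lemma num_at o' c : (o' + c <= D)%N -> num l N (o + o') c = num l i o' c.
Proof. by move=> h; rewrite hi (num_num l_gt1). Qed.

Lemma fvalidE : fvalid A o = valid_idx x i.
Proof.
apply: eq_existsb => a; rewrite ftileE; last by move: ho; rewrite /D; lia.
by rewrite /has_tile -num_at ?addn0 // /D; lia.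
Qed.

Lemma scol_lt : (scol x i < l ^ Ds)%N. Proof. exact: num_lt. Qed.
Lemma dg_scol a : (a < Ds)%N -> dg l N (tr (o + Nt + a)) = dg l (scol x i) a.
Proof.
move=> ha; rewrite /scol -num_at; last by rewrite /D; lia.
by rewrite dg_num // tr_val //; move: ho; rewrite /D; lia.
Qed.

Lemma dg_trow a : (a < Dt)%N -> dg l N (tr (o + (Nt + Ds) + a)) = dg l (trow x i) a.
Proof.
move=> ha; rewrite /trow -num_at; last by rewrite /D; lia.
by rewrite dg_num // tr_val //; move: ho; rewrite /D; lia.
Qed.

Lemma ftickE : (k <= Dt)%N -> ftick A o = ticking x (trow x i).
Proof.
move=> hk; congr (_ && _); apply: eq_forallb => a; have ha := ltn_ord a.
  by rewrite [LHS]/= dg_trow //; lia.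
by rewrite [at_first _ _]/= dg_trow.
Qed.

Lemma scol_split s : (s < l ^ Ds)%N -> 
  s = (dg l s Dt.+1 * l ^ Dt.+1 + (num l s 1 Dt * l + dg l s 0))%N.
Proof.
move=> hs; rewrite (dg_small l_gt1 hs) {1}(divn_eq s (l ^ Dt.+1)); congr (_ + _)%N.
rewrite /dg expn0 divn1 {1}(divn_eq (s %% l ^ Dt.+1) l); congr (_ * _ + _)%N.
  by rewrite /num expn1 expnS mulnC modn_divl.
by rewrite modn_dvdm // expnS dvdn_mulr.
Qed.

(** [scol_split] separates the top digit, the middle ones and the lowest. The top digit decides
    whether the column is before [start_col], the middle ones whether it is in the fixed part, and
    the lowest then gives the letter and detects the first and last fixed cells. *)
Lemma initE y : init_b (fbefore A o) (finbase A o) (at_first A (tr (o + Nt + 0)))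
   (at_last A (tr (o + Nt + 0))) (at_bit A (tr (o + Nt + 0))) y = init_ok x (start_col x) (scol x i) y
  /\ (~~ fbefore A o && ~~ finbase A o) = (start_col x + l <= scol x i)%N.
Proof.
have hs := scol_lt; set s := scol x i in hs *.
have es := scol_split hs.
have h1 : fbefore A o = (s < start_col x)%N.
  rewrite /fbefore /= dg_scol // -/s /start_col -/v -/l.
  have hm := num_lt l_gt1 s 1 Dt; have hc := dg_lt l_gt1 s 0; have ht := dg_lt l_gt1 s Dt.+1.
  move: hm hc ht es; move: (dg l s Dt.+1) (num l s 1 Dt) (dg l s 0) => t m c hm hc ht ->.
  have hmc : (m * l + c < l ^ Dt.+1)%N.
    rewrite expnS; apply: (@leq_trans (m * l + l)%N); first by rewrite ltn_add2l.
    by rewrite -mulSnr mulnC leq_mul2l hm orbT.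
  case: (eqVneq t l.-1) => [->|hne] /=; first by lia.
  have : (t * l ^ Dt.+1 + l ^ Dt.+1 <= l.-1 * l ^ Dt.+1)%N.
    by rewrite -mulSnr leq_mul2r; apply/orP; right; lia.
  lia.
have h2 : finbase A o = (num l s 1 Dt == 0%N).
  rewrite (zero_digits l_gt1 (num_lt l_gt1 _ _ _)); apply: eq_forallb => a; have ha := ltn_ord a.
  by rewrite /= dg_scol ?dg_num // /Ds; lia.
have h3 : ~~ (s < start_col x)%N -> dg l s Dt.+1 = l.-1.
  rewrite -h1 /fbefore /= dg_scol // negbK => /eqP ->; by [].
have h4 : ~~ (s < start_col x)%N -> s = (start_col x + (num l s 1 Dt * l + dg l s 0))%N.
  by move=> h; rewrite {1}es h3.
have hc := dg_lt l_gt1 s 0.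
have h5 : ~~ (s < start_col x)%N -> (s < start_col x + l)%N = (num l s 1 Dt == 0%N).
  move=> h; rewrite {1}(h4 h); move: (num l s 1 Dt) => [|m]; first by rewrite mul0n; lia.
  by rewrite mulSn; lia.
split; last first.
  rewrite h1 h2; case: (boolP (s < start_col x)%N) => h /=; first by lia.
  by rewrite -h5 // -leqNgt.
rewrite /init_b /init_ok size_base h1; case: ifP => [//|/negbT h].
rewrite h2 h5 //; case: eqP => // e0.
have es' : s = (start_col x + dg l s 0)%N by rewrite {1}(h4 h) e0 mul0n.
rewrite /= dg_scol // -/s nth_base; last by lia.
have -> : (s - start_col x)%N = dg l s 0 by lia.
have -> : (s == start_col x) = (dg l s 0 == 0%N) by lia.
by have -> : (s == (start_col x + l).-1) = (dg l s 0 == l.-1) by lia.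
Qed.

Lemma fselfE a : fself A o a = self_ok x (start_col x) (l ^ Ds) (l ^ Dt) (trow x i) (scol x i) a.
Proof.
have [h1 _] := initE (tl_mid a).
rewrite /fself h1 !fzeroE ?fmaxE ?num_at //; move: ho; rewrite /D; try lia.
Qed.

End At.

Section At2.
Variables (o i o' j : nat).
Hypotheses (ho : (o + D <= K)%N) (hi : i = num l N o D).
Hypotheses (ho' : (o' + D <= K)%N) (hj : j = num l N o' D).
Hypothesis hk : (k <= Dt)%N.

Lemma fconfE : fconf A o o' = conf_idx x i j.
Proof.
have hb : (o + Nt <= K)%N /\ (o' + Nt <= K)%N by move: ho ho'; rewrite /D; lia.
have hc : (o + Nt + Ds <= K)%N /\ (o' + Nt + Ds <= K)%N by move: ho ho'; rewrite /D; lia.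
have hd : (o + (Nt + Ds) + Dt <= K)%N /\ (o' + (Nt + Ds) + Dt <= K)%N by move: ho ho'; rewrite /D; lia.
case: hb hc hd => [b1 b2] [c1 c2] [d1 d2].
apply: eq_existsb => a; apply: eq_existsb => b.
rewrite !ftileE // /has_tile -(num_at hi (o' := 0)) ?addn0; last by rewrite /D; lia.
rewrite -(num_at hj (o' := 0)) ?addn0; last by rewrite /D; lia.
congr [&& _, _ & _].
have [_ hreg] := initE ho hi (tl_mid a).
rewrite /fclash /clash (fselfE ho hi) !feqE // !fsuccE //.
rewrite /fhor /fver hreg fzeroE // (ftickE ho hi hk).
rewrite !(num_at hi) ?(num_at hj) /hor_ok /ver_ok ?size_base //; by rewrite /D; lia.
Qed.

Lemma fsameE : feq A (o' + Nt) (o + Nt) (Ds + Dt) = (scell x j == scell x i).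
Proof.
rewrite feqE ?(num_at hi) ?(num_at hj) //; move: ho ho'; rewrite /D; lia.
Qed.
End At2.

End Counter.

Definition the_lpcc : lpcc := conflict_lpcc nn (valid_idx x) (scell x) (conf_idx x).
Definition hout : bset (bool * bool)%type K -> option (msym (bool * bool)%type K) -> seq bool :=
  fun Z pv => fpiece (atoms_of Z pv).
Definition ent (p i j : nat) : seq bool :=
  piece p (i == 0%N) (j == 0%N) (valid_idx x i) (valid_idx x j) (scell x j == scell x i) (conf_idx x i j).

(** The counter holds, from low to high, the column [j], the row [i] and the phase [ph]; counting
    therefore follows the order in which [enc_lpcc] lists the entries. *)
Lemma fpieceE ph i j : (k <= Dt)%N -> (ph < l ^ 4)%N -> (i < nn)%N -> (j < nn)%N ->
  fpiece (num_atoms K v (ph * (nn * nn) + (i * nn + j))) =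
  if binary_digits l 4 ph then ent (bin_value l 4 ph) i j else [::].
Proof.
move=> hk hph hi hj; set N := (_ + (_ + _))%N.
have ej : j = num l N 0 D.
  by rewrite /num /N expn0 divn1 mulnA modnMDl modnMDl modn_small.
have ei : i = num l N D D.
  rewrite /num /N mulnA addnA -mulnDl divnMDl // (divn_small hj) addn0.
  by rewrite modnMDl modn_small.
have ep : ph = num l N (D + D) 4.
  rewrite /num /N expnD divnMDl ?muln_gt0 ?nn_gt0 // divn_small ?addn0 ?modn_small //.
  by apply: (@leq_trans (i * nn + nn)%N); [rewrite ltn_add2l | rewrite -mulSnr leq_mul2r hi orbT].
have hK : (D + D + 4 = K)%N by rewrite /K addnS.
have hD0 : (0 + D <= K)%N by lia.
have hDD : (D + D <= K)%N by lia.
have hdg (b : 'I_4) : dg l N (tr (D + D + b)) = dg l ph b.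
  by rewrite ep dg_num // tr_val //; have := ltn_ord b; lia.
rewrite /fpiece (_ : [forall b, _] = binary_digits l 4 ph); last first.
  by apply: eq_forallb => b; rewrite /= hdg.
case: ifP => // _; rewrite /ent; congr piece.
- by apply: eq_bigr => b _; rewrite /= hdg.
- by rewrite fzeroE // -ei.
- by rewrite fzeroE // -ej.
- exact: fvalidE.
- exact: fvalidE.
- by rewrite -(fsameE hDD ei hD0 ej).
- exact: fconfE.
Qed.

Lemma flatten_first n (T : Type) (s : seq T) : (0 < n)%N ->
  flatten [seq (if j == 0%N then s else [::]) | j <- iota 0 n] = s.
Proof.
case: n => // n _ /=; rewrite (_ : [seq _ | j <- _] = [seq [::] | j <- iota 1 n]).
  by elim: (iota _ _) => //=; rewrite cats0.
by apply/eq_in_map => -[|i]; rewrite mem_iota.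
Qed.

Lemma enc_vecE n f : enc_vec (vec_of n f) = flatten [seq enc_entry (f i) | i <- iota 0 n].
Proof.
rewrite /enc_vec -val_enum_ord -map_comp; congr flatten.
by apply: eq_map => i /=; rewrite mxE.
Qed.

Lemma enc_matE n f : enc_mat (mat_of n f) =
  flatten [seq flatten [seq enc_entry (f i j) | j <- iota 0 n] | i <- iota 0 n].
Proof.
rewrite /enc_mat -[X in _ = flatten [seq _ | _ <- X]]val_enum_ord.
suff H (s : seq 'I_n) : flatten [seq enc_entry (mat_of n f i j) | i <- s, j <- enum 'I_n] =
    flatten [seq flatten [seq enc_entry (f i j) | j <- iota 0 n] | i <- map val s] by exact: H.
elim: s => //= i s IH; rewrite flatten_cat IH; congr (flatten _ ++ _).
by rewrite -val_enum_ord -map_comp; apply: eq_map => j /=; rewrite mxE.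
Qed.

Theorem generated_lpcc : (k <= Dt)%N -> generated hout x = enc_lpcc the_lpcc.
Proof.
move=> hk; rewrite /generated /outs -/v -/l.
have -> : [seq round_out p0 hout v N | N <- iota 0 (l ^ K)] =
    [seq fpiece (num_atoms K v N) | N <- iota 0 (l ^ K)].
  by apply: eq_map => N; rewrite /round_out /hout atomsE.
have -> : (l ^ K = l ^ 4 * (nn * nn))%N by rewrite -!expnD; congr (_ ^ _)%N; rewrite /K; lia.
rewrite flatten_iota_mul ?muln_gt0 ?nn_gt0 //.
(* [G p] is all that phase [p] writes. *)
pose G p := flatten [seq flatten [seq ent p i j | j <- iota 0 nn] | i <- iota 0 nn].
have -> : [seq flatten [seq fpiece (num_atoms K v (ph * (nn * nn) + r)) | r <- iota 0 (nn * nn)] | ph <- iota 0 (l ^ 4)] =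
   [seq (if binary_digits l 4 ph then G (bin_value l 4 ph) else [::]) | ph <- iota 0 (l ^ 4)].
  apply/eq_in_map => ph; rewrite mem_iota => /andP[_ hph].
  rewrite (flatten_iota_mul (fun r => fpiece (num_atoms K v (ph * (nn * nn) + r)))) //.
  have e i j : (i < nn)%N -> (j < nn)%N -> _ := fun hi hj => fpieceE hk hph hi hj.
  have -> : [seq flatten [seq fpiece (num_atoms K v (ph * (nn * nn) + (i * nn + j))) | j <- iota 0 nn] | i <- iota 0 nn] =
     [seq flatten [seq (if binary_digits l 4 ph then ent (bin_value l 4 ph) i j else [::]) | j <- iota 0 nn] | i <- iota 0 nn].
    apply/eq_in_map => i; rewrite mem_iota => /andP[_ hi]; congr flatten.
    by apply/eq_in_map => j; rewrite mem_iota => /andP[_ hj]; apply: e.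
  case: ifP => // _.
  have nil (s : seq nat) : flatten [seq [::] | _ <- s] = [::] :> seq bool by elim: s.
  by rewrite nil nil.
rewrite flatten_binary // [flatten _]/= /enc_lpcc /the_lpcc /=.
rewrite !enc_vecE !enc_matE.
have first1 p (g : nat -> seq bool) : (forall i j, ent p i j = if j == 0%N then g i else [::]) ->
    G p = flatten [seq g i | i <- iota 0 nn].
  move=> h; congr flatten; apply: eq_map => i.
  by rewrite -[RHS](flatten_first (g i) nn_gt0); congr flatten; apply: eq_map => j.
rewrite (first1 0%N (fun=> [:: true])) // (first1 2%N (fun i => enc_entry (first_entry i))) //.
rewrite (first1 3%N (fun=> enc_entry 0)) // (first1 4%N (fun=> enc_entry 0)) //.
rewrite (first1 5%N (fun i => enc_entry (first_entry i))) //.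
have -> : G 1%N = [:: false].
  rewrite (first1 1%N (fun i => if i == 0%N then [:: false] else [::])) ?flatten_first // => i j.
  by rewrite /ent /=; case: (i == 0%N); case: (j == 0%N).
have Gnil p : (forall i j, ent p i j = [::]) -> G p = [::].
  move=> h; rewrite /G; elim: (X in map _ X) => //= i s ->; rewrite cats0.
  by elim: (iota _ _) => //= j s' ->; rewrite h.
(* Four binary digits give sixteen phases, of which the last six are empty. *)
rewrite !(Gnil 10%N, Gnil 11%N, Gnil 12%N, Gnil 13%N, Gnil 14%N, Gnil 15%N) //.
have -> : flatten [seq [:: true] | _ <- iota 0 nn] = nseq nn true.
  by rewrite -{2}(size_iota 0 nn); elim: (iota 0 nn) => //= i s ->.
by rewrite !cats0.
Qed.

End Correct.
End Instance.

(** * Correctness of the reduction *)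

Section Choosable.
Variables (V : TM) (k Dt : nat) (x : seq bool).
Let v := base_word x.
Let l := size v.
Let l_gt1 : (1 < l)%N. Proof. by rewrite /l size_base_word. Qed.
Let l_gt0 : (0 < l)%N := ltnW l_gt1.
Local Notation Nt := (Nt V).
Local Notation Ds := (Ds Dt).
Local Notation nn := (l ^ D V Dt)%N.
Local Notation p0 := (false, false).

Definition index (t s : nat) (a : tile V) : nat := ((t * l ^ Ds + s) * l ^ Nt + tcode x a)%N.

Lemma tcode_inj : injective (@tcode V x).
Proof.
move=> a b /eqP; rewrite /tcode -/v -/l eqn_pmul2l ?eqn_exp2l //; last by lia.
by move=> /eqP /ord_inj /enum_rank_inj.
Qed.

Lemma tcode_gt0 (a : tile V) : (0 < tcode x a)%N.
Proof. by rewrite /tcode -/v -/l muln_gt0 expn_gt0 l_gt0 andbT; lia. Qed.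

(** Tile codes are positive, so index 0 belongs to no tile and is available for the variable z. *)
Lemma valid_idx0 : valid_idx V x 0 = false.
Proof.
apply/existsP => -[a]; rewrite /has_tile /num div0n mod0n => /eqP h.
by have := tcode_gt0 a; rewrite -h.
Qed.

Section Index.
Variables (t s : nat) (a : tile V).
Hypotheses (ht : (t < l ^ Dt)%N) (hs : (s < l ^ Ds)%N).
Let hc : (tcode x a < l ^ Nt)%N := tcode_lt 0 x a.

Lemma index_lt : (index t s a < nn)%N.
Proof.
rewrite /D expnD mulnC expnD /index.
have h1 : (t * l ^ Ds + s < l ^ Dt * l ^ Ds)%N.
  apply: (@leq_trans (t * l ^ Ds + l ^ Ds)%N); first by rewrite ltn_add2l.
  by rewrite -mulSnr leq_mul2r ht orbT.
apply: (@leq_trans ((t * l ^ Ds + s) * l ^ Nt + l ^ Nt)%N); first by rewrite ltn_add2l.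
by rewrite -mulSnr [(l ^ Ds * _)%N]mulnC leq_mul2r h1 orbT.
Qed.

Lemma scell_index : scell V Dt x (index t s a) = (t * l ^ Ds + s)%N.
Proof.
rewrite /scell -/v -/l /num /index divnMDl ?expn_gt0 ?l_gt0 // (divn_small hc) addn0 modn_small //.
rewrite expnD mulnC; apply: (@leq_trans (t * l ^ Ds + l ^ Ds)%N); first by rewrite mulnC ltn_add2l.
by rewrite -mulSnr mulnC leq_mul2l ht orbT.
Qed.

Lemma scol_index : scol V Dt x (index t s a) = s.
Proof.
have := @num_num l l_gt1 (index t s a) Nt (Ds + Dt) 0 Ds; rewrite addn0 add0n => /(_ (leq_addr _ _)).
by rewrite /scol -/v -/l => <-; rewrite -/(scell V Dt x _) scell_index /num expn0 divn1 modnMDl modn_small.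
Qed.

Lemma trow_index : trow V Dt x (index t s a) = t.
Proof.
have := @num_num l l_gt1 (index t s a) Nt (Ds + Dt) Ds Dt => /(_ (leqnn _)).
rewrite /trow -/v -/l => <-; rewrite -/(scell V Dt x _) scell_index /num.
by rewrite divnMDl ?expn_gt0 ?l_gt0 // (divn_small hs) addn0 modn_small.
Qed.

Lemma has_tile_index : has_tile x (index t s a) a.
Proof. by rewrite /has_tile -/v -/l /num expn0 divn1 /index modnMDl modn_small. Qed.

End Index.

Lemma indexK i (a : tile V) : (i < nn)%N -> has_tile x i a -> i = index (trow V Dt x i) (scol V Dt x i) a.
Proof.
move=> hi /eqP ha; rewrite /index -ha /num expn0 divn1 {1}(divn_eq i (l ^ Nt)); congr (_ * _ + _)%N.
have hci : (i %/ l ^ Nt < l ^ (Ds + Dt))%N.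
  by rewrite ltn_divLR ?expn_gt0 ?l_gt0 // -expnD [(_ + Nt)%N]addnC.
rewrite {1}(divn_eq (i %/ l ^ Nt) (l ^ Ds)); congr (_ * _ + _)%N.
rewrite /trow -/v -/l /num expnD divnMA modn_small // ltn_divLR ?expn_gt0 ?l_gt0 //.
by rewrite -expnD addnC.
Qed.

Lemma has_tile_inj i (a b : tile V) : has_tile x i a -> has_tile x i b -> a = b.
Proof. by move=> /eqP h1 /eqP h2; apply: tcode_inj; rewrite -h1. Qed.

Lemma choosable_tiling :
  choosable nn (valid_idx V x) (scell V Dt x) (conf_idx V k Dt x) <->
  exists A, @tiling V x (start_col Dt x) (l ^ Ds) (l ^ Dt) (ticking k Dt x) A.
Proof.
split.
- move=> [S [hS1 hS2]].
  pose c0 : cell V := (None, Blank, false, false); pose a0 : tile V := (c0, c0, c0).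
  pose A t s := odflt a0 [pick a | S (index t s a)].
  (* Any tile gives a valid index in the cell at row [t] and column [s]; [a0] serves to invoke the
     covering condition there. *)
  have hA t s : (t < l ^ Dt)%N -> (s < l ^ Ds)%N -> S (index t s (A t s)).
    move=> ht hs; have hv : valid_idx V x (index t s a0) by apply/existsP; exists a0; exact: has_tile_index.
    have [j [hj hSj /existsP [b hb] hc]] := hS1 _ (index_lt _ ht hs) hv.
    have hjb : j = index t s b.
      rewrite (indexK hj hb); move: hc; rewrite scell_index // (indexK hj hb).
      rewrite scell_index ?num_lt // => /eqP.
      have h1 := @num_lt l l_gt1 j Nt Ds.
      rewrite -/(scol V Dt x j) in h1 => /eqP e.
      have e1 : trow V Dt x j = t.
        have := congr1 (fun z => z %/ l ^ Ds)%N e.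
        by rewrite !divnMDl ?expn_gt0 ?l_gt0 // !divn_small // !addn0.
      have e2 : scol V Dt x j = s.
        by have := congr1 (fun z => z %% l ^ Ds)%N e; rewrite !modnMDl !modn_small.
      by rewrite e1 e2 trow_index // scol_index.
    rewrite /A; case: pickP => [a -> //|/(_ b)]; by rewrite -hjb hSj.
  have hcl t s t' s' : (t < l ^ Dt)%N -> (s < l ^ Ds)%N -> (t' < l ^ Dt)%N -> (s' < l ^ Ds)%N ->
     clash k Dt x (index t s (A t s)) (index t' s' (A t' s')) (A t s) (A t' s') = false.
    move=> ht hs ht' hs'; apply/negbTE/negP => hc.
    have := hS2 _ _ (index_lt (A t s) ht hs) (index_lt (A t' s') ht' hs').
    have hv t1 s1 a : (t1 < l ^ Dt)%N -> (s1 < l ^ Ds)%N -> valid_idx V x (index t1 s1 a).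
      by move=> h1 h2; apply/existsP; exists a; exact: has_tile_index.
    move=> /(_ (hv _ _ _ ht hs) (hv _ _ _ ht' hs') (hA _ _ ht hs) (hA _ _ ht' hs')) /negbT /negP; apply.
    apply/existsP; exists (A t s); apply/existsP; exists (A t' s').
    by rewrite !has_tile_index.
  exists A; split=> t s ht hs.
  (* The clash of an index with itself yields [self_ok]. *)
  + have /negbT := hcl t s t s ht hs ht hs; rewrite /clash trow_index // scol_index //.
    by rewrite negb_or negbK => /andP[].
  + have /negbT := hcl t s t s.+1 ht (ltnW hs) ht hs; rewrite /clash !trow_index ?scol_index //; try exact: ltnW.
    by rewrite !negb_or !negbK !eqxx /= negbK => /andP[_ /andP[]].
  + have ht' := ltnW ht.
    have /negbT := hcl t s t.+1 s ht' hs ht hs; rewrite /clash !trow_index ?scol_index //.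
    by rewrite !negb_or !negbK !eqxx /= negbK => /andP[_ /andP[_]].
- move=> [A [h1 h2 h3]].
  exists (fun i => has_tile x i (A (trow V Dt x i) (scol V Dt x i))); split.
    move=> i hi /existsP [a ha].
    have ht := @num_lt l l_gt1 i (Nt + Ds) Dt; have hs := @num_lt l l_gt1 i Nt Ds.
    exists (index (trow V Dt x i) (scol V Dt x i) (A (trow V Dt x i) (scol V Dt x i))); split.
    + exact: index_lt.
    + by rewrite trow_index // scol_index // has_tile_index.
    + by apply/existsP; eexists; exact: has_tile_index.
    + by rewrite scell_index // [in RHS](indexK hi ha) scell_index.
  move=> i j hi hj _ _ hSi hSj; apply/negbTE/existsP => -[a /existsP [b /and3P[ha hb]]].
  rewrite (has_tile_inj ha hSi) (has_tile_inj hb hSj) /clash.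
  have ht := @num_lt l l_gt1 i (Nt + Ds) Dt; have hs := @num_lt l l_gt1 i Nt Ds.
  have ht' := @num_lt l l_gt1 j (Nt + Ds) Dt; have hs' := @num_lt l l_gt1 j Nt Ds.
  rewrite h1 //= => /orP[/and3P[/eqP e1 /eqP e2]|/and3P[/eqP e1 /eqP e2]].
  + by rewrite -e1 e2 h2 // -e2.
  + by rewrite e1 -e2 h3 // -e1.
Qed.

(** Induction on [c], splitting off the top digit, which is flagged for [(size x).+2] of its [l]
    values. *)
Lemma sum_digits_flag c :
  (\sum_(0 <= t < l ^ c) [forall a : 'I_c, (nth p0 v (dg l t a)).2] = (size x).+2 ^ c)%N.
Proof.
elim: c => [|c IH].
  by rewrite expn0 big_nat1 (_ : [forall _, _] = true) //; apply/forallP; case.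
have hlc : (0 < l ^ c)%N by rewrite expn_gt0 l_gt0.
have flags : (\sum_(0 <= d < l) (nth p0 v d).2 = (size x).+2)%N.
  rewrite -(big_nth p0 xpredT (fun z : bool * bool => nat_of_bool z.2)) /v /base_word big_cat /=.
  rewrite big_flatten big_map !big_cons big_nil /= (eq_bigr (fun=> 1%N)) => [|b _].
    by rewrite sum1_size addn2.
  by rewrite !big_cons big_nil.
rewrite [in LHS]expnS big_nat_mul [RHS]expnS -{1}flags big_distrl /=; apply: eq_big_nat => d /andP[_ hd].
rewrite -{1}[(d * l ^ c)%N]add0n mulSn big_addn addnK -IH big_distrr /=.
apply: eq_big_nat => r /andP[_ hr].
have e1 : dg l (r + d * l ^ c) c = d.
  by rewrite /dg addnC divnMDl // (divn_small hr) addn0 modn_small.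
have e2 a : (a < c)%N -> dg l (r + d * l ^ c) a = dg l r a.
  by move=> ha; rewrite -(@dg_mod l l_gt1 (_ + _) c) // addnC modnMDl dg_mod.
rewrite mulnb; congr nat_of_bool; apply/forallP/andP => [h|[h3 /forallP h4] a].
  split; first by have := h ord_max; rewrite /= e1.
  by apply/forallP => a; have := h (widen_ord (leqnSn c) a); rewrite /= e2.
have := ltn_ord a; rewrite ltnS leq_eqVlt => /orP[/eqP ->|ha]; first by rewrite e1.
by rewrite e2 //; exact: (h4 (Ordinal ha)).
Qed.

(** No row from [l ^ k] on ticks, since it has a nonzero digit at position [k] or higher; [k < Dt]
    puts all ticking rows before the last one. *)
Lemma ticks_total : (k < Dt)%N -> ticks (ticking k Dt x) (l ^ Dt).-1 = ((size x).+2 ^ k)%N.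
Proof.
move=> hk; have hkD : (l ^ k <= (l ^ Dt).-1)%N.
  have : (l ^ k < l ^ Dt)%N by rewrite ltn_exp2l.
  lia.
rewrite /ticks (big_cat_nat (leq0n _) hkD) /= [X in (_ + X)%N]big_nat_cond [X in (_ + X)%N]big1 ?addn0; last first.
  move=> t /andP[/andP[h1 h2] _]; apply/eqP; rewrite eqb0 negb_and; apply/orP; right.
  apply/negP => /forallP h; move: h1; apply/negP; rewrite -ltnNge.
  have htD : (t < l ^ Dt)%N by lia.
  have -> : t = (t %% l ^ k)%N.
    apply: (@dg_inj l l_gt1 Dt) => //.
      by apply: leq_ltn_trans htD; exact: leq_mod.
    move=> a ha; case: (ltnP a k) => hak; first by rewrite dg_mod.
    have /eqP -> : dg l t a == 0%N by have := h (Ordinal ha); rewrite /= hak.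
    rewrite /dg divn_small ?mod0n //; apply: (@leq_trans (l ^ k)%N); last by rewrite leq_exp2l.
    by rewrite ltn_pmod // expn_gt0 l_gt0.
  by rewrite ltn_pmod // expn_gt0 l_gt0.
rewrite -sum_digits_flag; apply: eq_big_nat => t /andP[_ ht]; congr nat_of_bool.
rewrite /ticking -/v -/l andbC (_ : [forall _, _] = true) //; apply/forallP => a; apply/implyP => hak.
rewrite /dg divn_small ?mod0n //; apply: leq_trans ht _; by rewrite leq_exp2l.
Qed.

End Choosable.

Lemma tm_run_mono (M : TM) t t' (c c' : config M) : (t <= t')%N -> tm_run t c = Some c' -> tm_run t' c = Some c'.
Proof.
elim: t t' c => [|t IH] [|t'] c //=; case: (tm_step c) => [c1|] //.
exact: IH.
Qed.

(** Base and [c] are both at most the base to the power [k.+1]; two further factors, each at least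
    2, absorb the sum and the additive 2. *)
Lemma leq_size_base_word (x : seq bool) k c : (c <= (size x).+2 ^ k)%N ->
  ((size (base_word x) + c).+2 <= size (base_word x) ^ (k + 3))%N.
Proof.
have hl := size_base_word x; set l := size _ in hl *.
move=> hc; have h1 : ((size x).+2 ^ k <= l ^ k)%N by case: (k) => // k'; rewrite leq_exp2r //; lia.
have h2 : (l ^ k <= l ^ k.+1)%N by rewrite leq_exp2l //; lia.
have h3 : (l <= l ^ k.+1)%N by rewrite -{1}(expn1 l) leq_exp2l //; lia.
have -> : (l ^ (k + 3) = l * (l * l ^ k.+1))%N by rewrite addnS addnS addn1 !expnS.
have : (2 * (2 * l ^ k.+1) <= l * (l * l ^ k.+1))%N by rewrite leq_mul ?leq_mul //; lia.
lia.
Qed.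

(** The verifier reads at most [l ^ (k + 3)] letters, so it halts within [l ^ ((k + 3) * kV)] steps;
    the rest of [Dt] makes the number of rows exceed this and leaves room for witness and marker. *)
Theorem lpcc_accepts (V : TM) (k kV : nat) (x : seq bool) (R : realType)
  (Dt := ((k + 3) * kV + k + 3)%N) :
  (forall y, exists c, tm_run ((size y).+2 ^ kV) (tm_init V y) = Some c) ->
  [/\ binary (the_lpcc V k Dt x), lpcc_bounded R (the_lpcc V k Dt x) & (0 < lp_dim (the_lpcc V k Dt x))%N] /\
  (lpcc_opt R (the_lpcc V k Dt x) = 0 \/ lpcc_opt R (the_lpcc V k Dt x) = 1) /\
  (lpcc_opt R (the_lpcc V k Dt x) = 1 <->
   exists w, (size w <= (size x).+2 ^ k)%N /\ tm_outputs V (pair_enc x w) [:: true]).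
Proof.
move=> hV; set l := size (base_word x).
have hl : (1 < l)%N by rewrite /l size_base_word.
have hn : (0 < l ^ D V Dt)%N by rewrite expn_gt0 ltnW.
have hk : (k < Dt)%N by rewrite /Dt; lia.
have htk := ticks_total x hk.
have hT : (0 < l ^ Dt)%N by rewrite expn_gt0 ltnW.
have hbase : size (pair_enc x [::]) = l := size_base x.
have v0 := @valid_idx0 V x.
have acc : choosable (l ^ D V Dt) (valid_idx V x) (scell V Dt x) (conf_idx V k Dt x) <->
   exists w, (size w <= (size x).+2 ^ k)%N /\ tm_outputs V (pair_enc x w) [:: true].
  rewrite choosable_tiling -htk; apply: tiling_iff => //.
  - by rewrite /start_col -/l expnS mulnA leq_pmull // muln_gt0; lia.
  - rewrite hbase htk; have := leq_size_base_word (leqnn ((size x).+2 ^ k)%N); rewrite -/l => h.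
    have h2 : (l ^ (k + 3) <= l ^ Dt)%N by rewrite leq_exp2l // /Dt; lia.
    have h3 : (2 * l ^ Dt <= l ^ Dt.+1)%N by rewrite expnS leq_mul2r hl orbT.
    have h4 : (start_col Dt x + l ^ Dt.+1 = l ^ Ds Dt)%N.
      by rewrite /start_col -/l /Ds [RHS]expnS -mulSnr prednK // ltnW.
    by rewrite -h4; lia.
  - move=> w; rewrite htk => hw; have [c hc] := hV (pair_enc x w); exists c.
    apply: tm_run_mono hc.
    have hs : size (pair_enc x w) = (l + size w)%N by rewrite pair_enc_cat size_cat hbase.
    have h := leq_size_base_word hw; rewrite -/l -hs in h.
    have : (l ^ ((k + 3) * kV) < l ^ Dt)%N by rewrite ltn_exp2l // /Dt; lia.
    have : ((size (pair_enc x w)).+2 ^ kV <= l ^ ((k + 3) * kV))%N.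
      by rewrite expnM; case: (kV) => // k'; rewrite leq_exp2r.
    by move=> h1 h2; rewrite -ltnS prednK //; exact: leq_ltn_trans h1 h2.
have hbd := @conflict_lpcc_bounded _ _ (scell V Dt x) (conf_idx V k Dt x) hn v0 R.
have o1 := @conflict_lpcc_opt1 _ _ (scell V Dt x) (conf_idx V k Dt x) hn v0 R.
have o0 := @conflict_lpcc_opt0 _ _ (scell V Dt x) (conf_idx V k Dt x) hn v0 R.
split; first by split=> //; exact: conflict_lpcc_binary.
rewrite -acc; case: (pselect (choosable (l ^ D V Dt) (valid_idx V x) (scell V Dt x) (conf_idx V k Dt x))) => h.
  by split; [right; exact: o1 | split=> // _; exact: o1].
split; first by left; exact: o0.
split=> [e|//]; have := o0 h; rewrite /the_lpcc -/l in e *; rewrite e => /eqP; by rewrite oner_eq0.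
Qed.

(** [pair_enc] doubles the sign bit and then the bits of the numerator. The next two letters are
    thus a doubled bit if the numerator is nonzero, and the separator [false], [true] if it is 0. *)
Lemma rat_enc_sign (v : rat) : 0 <= v ->
  (4 <= size (rat_enc v))%N /\ (0 < v <-> nth false (rat_enc v) 2 = nth false (rat_enc v) 3).
Proof.
move=> hv; rewrite /rat_enc; split; first by rewrite /pair_enc !size_cat /=; lia.
rewrite le_eqVlt in hv; case/orP: hv => [/eqP <-|hv].
  have -> : numq (0 : rat) = 0 by apply/eqP; rewrite numq_eq0.
  by rewrite !ltxx.
have : (0 < `|numq v|)%N by rewrite absz_gt0 numq_eq0 gt_eqF.
by rewrite hv /bits; case: (`|numq v|%N) => // m _ /=.
Qed.

Theorem theorem7 (R : realType) (eps : R) (eps_gt0 : 0 < eps) :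
  ~ P_eq_NP ->
  ~ exists M : TM, polytime M /\
      forall I : lpcc, binary I -> lpcc_bounded R I ->
        exists v : rat, tm_outputs M (enc_lpcc I) (rat_enc v) /\
          between (lpcc_opt R I / (lp_dim I)%:R `^ (1 - eps)) (lpcc_opt R I) (ratr v).
Proof.
move=> hPNP [M [hM happ]]; apply: hPNP => L [V [k [[kV hV] hL]]].
pose Dt := ((k + 3) * kV + k + 3)%N.
(* The output function depends on the verifier [V], [k] and [Dt] alone, not on [x]. *)
apply: (@reduction_in_P (K V Dt) (@hout V k Dt) M L hM) => x.
have [[hb hbd hdim] [hopt hacc]] := lpcc_accepts k x R hV.
have [v [hout hbt]] := happ _ hb hbd.
exists (rat_enc v); rewrite generated_lpcc; last by rewrite /Dt; lia.
have hpos : 0 < (lp_dim (the_lpcc V k Dt x))%:R `^ (1 - eps) :> R by apply: powR_gt0; rewrite ltr0n.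
have [hv0 hv1] : 0 <= v /\ (0 < v <-> lpcc_opt R (the_lpcc V k Dt x) = 1).
  case: hopt => e; move: hbt; rewrite /Dt e /between.
    (* For optimum 0 both bounds are 0, so [v] is exactly 0. *)
    rewrite mul0r minxx maxxx -eq_le eq_sym fmorph_eq0 => /eqP ->.
    by rewrite lexx ltxx; split=> //; split=> // h01; have := oner_eq0 R; rewrite -h01 eqxx.
  rewrite mul1r => /andP[h _].
  (* For optimum 1 both bounds are positive, whatever the sign of [1 - eps], so the minimum in
     [between] is positive. *)
  have : 0 < ratr v :> R by apply: lt_le_trans h; rewrite lt_min invr_gt0 hpos ltr01.
  by rewrite ltr0q => h0; split; [exact: ltW | split].
have [hs hsg] := rat_enc_sign hv0.
split=> //; by rewrite -hsg hv1 hacc hL.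
Qed.
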